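(* Let the standing assumptions (see context) hold for $T,m,n,r,F,B,L_F,\varepsilon_r$. There is a constant $h_*>0$, depending only on $m,n,r$ and $L_F$, such that the following holds. Fix a positive integer $p$ and an explicit Runge--Kutta tableau $(a_{ij},b_i,c_i)_{1\le i,j\le s_{\mathrm{RK}}}$ (with $a_{ij}=0$ for $j\ge i$, $c_i=\sum_{j<i}a_{ij}\in[0,1]$) with real coefficients independent of $h$, $n$, and the singular values. Suppose that $$\sum_{i=1}^{s_{\mathrm{RK}}}b_i=1,\qquad\sum_{i=1}^{s_{\mathrm{RK}}}b_ic_i^k=\frac1{k+1}\quad(1\le k\le p-1).$$ For $0<h\le h_0\le\min(1,h_* )$ and $0\le t_n\le T-h$, consider a rank-admissible computation of one step of the projector-splitting Runge--Kutta method from a rank-$r$ matrix $Y_n=U_nS_nV_n^\top$. Let $A_n$ solve $\dot A_n(s)=F(t_n+s,A_n(s))$, $A_n(0)=Y_n$, and set $g_n(s):=F(t_n+s,A_n(s))$. Assume that $g_n\in C^p([0,h])$ with $$\sup_{0\le s\le h}\|g_n^{(p)}(s)\|\le M_p,\qquad\|Y_{n,i}-A_n(c_ih)\|\le C_{\rm st}(h^p+h\varepsilon_r)\quad\text{if }b_i\ne0,$$ where the bounds $M_p,C_{\rm st}$ hold uniformly for $0<h\le h_0$, and $h_0,M_p,C_{\rm st}$ are independent of the singular values. Then $$d_n\le C(h^{p+1}+h^2\varepsilon_r),\qquad\|Y_{n+1}-A_n(h)\|\le C(h^{p+1}+h\varepsilon_r),$$ where $d_n:=\|Y_n+\Delta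 A_n-A_n(h)\|$. If the same $h_0,M_p,C_{\rm st}$ apply at every step of a rank-admissible computation with $t_n=t_0+nh$ started from a rank-$r$ matrix $Y_0=U_0S_0V_0^\top$, then for the solution $A(t)$ of $\dot A(t)=F(t,A(t))$, $A(t_0)=A_0$, on $[t_0,T]$, with $\|Y_0-A(t_0)\|\le\delta$, $$\max_{t_n\le T}\|Y_n-A(t_n)\|\le C_T(\delta+\varepsilon_r+h^p).$$ Here the constant $C$ depends only on $m,n,r,B,L_F,p$, the fixed tableau, and $M_p,C_{\rm st}$; $C_T$ may in addition depend on $T$. Both are independent of the singular values of the numerical approximations.
   Context: $\|\cdot\|$ is the Frobenius norm. Standing assumptions: $T>0$; $m,n,r$ are integers with $1\le r<\min(m,n)$; $F:[0,T]\times\mathbb{R}^{m\times n}\to\mathbb{R}^{m\times n}$ is continuous, and there are constants $B,L_F$ such that for all $t\in[0,T]$ and $X,Z\in\mathbb{R}^{m\times n}$, $$\|F(t,X)\|\le B,\qquad\|F(t,X)-F(t,Z)\|\le L_F\|X-Z\|;$$ and for some $\varepsilon_r\ge0$, for all $t\in[0,T]$ and every rank-$r$ matrix $Y=USV^\top$ ($U\in\mathbb{R}^{m\times r}$, $V\in\mathbb{R}^{n\times r}$ with orthonormal columns, $S\in\mathbb{R}^{r\times r}$ invertible), $$\|(I-UU^\top)F(t,Y)(I-VV^\top)\|\le\varepsilon_r.$$ Reduced $K$-$L$ step, started from $(U_0,S_0,V_0)$ with increment $\Delta A\in\mathbb{R}^{m\times n}$ (where $Y_0=U_0S_0V_0^\top$,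 $U_0^\top U_0=V_0^\top V_0=I_r$, $S_0$ invertible): (1) set $K_1:=U_0S_0+\Delta A\,V_0=(Y_0+\Delta A)V_0$ and compute a factorization $U_1\widehat S_1=K_1$, where $U_1\in\mathbb{R}^{m\times r}$ has orthonormal columns; (2) set $L_1:=V_0S_0^\top U_0^\top U_1+\Delta A^\top U_1=(Y_0+\Delta A)^\top U_1$ and compute a factorization $V_1S_1^\top=L_1$, where $V_1\in\mathbb{R}^{n\times r}$ has orthonormal columns. The output is $Y_1:=U_1S_1V_1^\top$. The step is rank-admissible when $\operatorname{rank}K_1=r$ (then also $\operatorname{rank}L_1=r$, so $S_1$ is invertible). A computation with several steps or stages is rank-admissible when every reduced $K$-$L$ step in it is rank-admissible. One step of the projector-splitting Runge--Kutta method from $Y_n=U_nS_nV_n^\top$ ($U_n^\top U_n=V_n^\top V_n=I_r$, $S_n$ invertible) at time $t_n$ with stepsize $h$: set $Y_{n,1}:=Y_n$ and $F_{n,1}:=F(t_n,Y_n)$. For $i=2,\dots,s_{\mathrm{RK}}$, set $\Delta A_{n,i}:=h\sum_{j=1}^{i-1}a_{ij}F_{n,j}$, apply the reduced $K$-$L$ step to $(U_n,S_n,V_n)$ with increment $\Delta A_{n,i}$, call its output $Y_{n,i}$, and set $F_{n,i}:=F(t_n+c_ih,Y_{n,i})$. Finally set $\Delta A_n:=h\sum_{i=1}^{s_{\mathrm{RK}}}b_iF_{n,i}$ and apply the reduced $K$-$L$ step to $(U_n,S_n,V_n)$ with increment $\Delta A_n$; its output is $Y_{n+1}=U_{n+1}S_{n+1}V_{n+1}^\top$.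 All stages and the final update start from the same factors $(U_n,S_n,V_n)$. *)

(* Defs.v *)
From HB Require Import structures.
From mathcomp Require Import all_boot all_order all_algebra.
From mathcomp Require Import all_classical all_reals all_analysis.

Set Implicit Arguments.
Unset Strict Implicit.
Unset Printing Implicit Defensive.

Import Order.TTheory GRing.Theory Num.Theory.
Import numFieldNormedType.Exports.

Local Open Scope classical_set_scope.
Local Open Scope ring_scope.

(* The library norm `|A| on matrices is the max norm; it induces the same
   topology as the Frobenius norm, so limits below may use either. *)
Definition frob (R : realType) (m n : nat) (A : 'M[R]_(m, n)) : R :=
  Num.sqrt (\sum_(i < m) \sum_(j < n) A i j ^+ 2).

(* Derivatives relative to a set D: two-sided in the interior of an interval,
   one-sided at its endpoints. At a point of D the values of f outside D play
   no role. *)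
Section WithinDerivative.
Variables (R : realType) (V : normedModType R).
Implicit Types (D : set R) (f : R -> V) (t : R).

Definition diff_quotient f t : R -> V :=
  fun u => (u - t)^-1 *: (f u - f t).

Definition is_derive_within D f t (l : V) : Prop :=
  diff_quotient f t @ within D t^' --> l.

Definition derivable_within D f t : Prop :=
  cvg (diff_quotient f t @ within D t^').

Definition derive_within D f t : V :=
  lim (diff_quotient f t @ within D t^').

Definition derive_within_n D (k : nat) f : R -> V :=
  iter k (derive_within D) f.

Definition Cp_on (p : nat) D f : Prop :=
  (forall k, (k < p)%N ->
     forall t, D t -> derivable_within D (derive_within_n D k f) t) /\
  {within D, continuous (derive_within_n D p f)}.

Definition solves_ivp (G : R -> V -> V) (a b : R) (x0 : V) (x : R -> V) : Prop :=
  x a = x0 /\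
  forall t, t \in `[a, b] -> is_derive_within [set` `[a, b]] x t (G t (x t)).

End WithinDerivative.

Record factors (R : realType) (m n r : nat) := Factors {
  facU : 'M[R]_(m, r);
  facS : 'M[R]_r;
  facV : 'M[R]_(n, r)
}.

Section LowRank.
Variables (R : realType) (m n r : nat).
Implicit Types (X : factors R m n r) (dA : 'M[R]_(m, n)).

Definition orthonormal_cols (k : nat) (Q : 'M[R]_(k, r)) : Prop :=
  Q^T *m Q = 1%:M.

Definition fmat X : 'M[R]_(m, n) := facU X *m facS X *m (facV X)^T.

Definition rank_r_factors X : Prop :=
  [/\ orthonormal_cols (facU X), orthonormal_cols (facV X)
    & facS X \in unitmx].

(* F is a total function, but only its restriction to [0, T] is constrained. *)
Record standing_assumptions (T B LF eps : R)
    (F : R -> 'M[R]_(m, n) -> 'M[R]_(m, n)) : Prop := StandingAssumptions {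
  sa_continuous :
    {within `[0, T] `*` [set: 'M[R]_(m, n)],
      continuous (fun tX : R * 'M[R]_(m, n) => F tX.1 tX.2)};
  sa_bounded : forall t Z, t \in `[0, T] -> frob (F t Z) <= B;
  sa_lipschitz : forall t Y Z, t \in `[0, T] ->
    frob (F t Y - F t Z) <= LF * frob (Y - Z);
  sa_eps_ge0 : 0 <= eps;
  sa_normal_defect : forall t X, t \in `[0, T] -> rank_r_factors X ->
    frob ((1%:M - facU X *m (facU X)^T) *m F t (fmat X)
            *m (1%:M - facV X *m (facV X)^T)) <= eps
}.

Definition kl_K X dA : 'M[R]_(m, r) := facU X *m facS X + dA *m facV X.

Definition kl_L X dA (U1 : 'M[R]_(m, r)) : 'M[R]_(n, r) :=
  facV X *m (facS X)^T *m (facU X)^T *m U1 + dA^T *m U1.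

(* A relation, since the orthonormal factorizations are not unique. *)
Definition kl_step X dA X1 : Prop :=
  [/\ orthonormal_cols (facU X1),
      exists Shat : 'M[R]_r, facU X1 *m Shat = kl_K X dA,
      orthonormal_cols (facV X1)
    & facV X1 *m (facS X1)^T = kl_L X dA (facU X1)].

Definition kl_admissible X dA : Prop := \rank (kl_K X dA) = r.

End LowRank.

Record tableau (R : realType) (s : nat) := Tableau {
  tab_a : 'I_s -> 'I_s -> R;
  tab_b : 'I_s -> R;
  tab_c : 'I_s -> R
}.

Section RungeKutta.
Variables (R : realType) (m n r s : nat) (tab : tableau R s).
Variable F : R -> 'M[R]_(m, n) -> 'M[R]_(m, n).
Implicit Types (Xn : factors R m n r) (Ys Fs : 'I_s -> 'M[R]_(m, n)).

Definition explicit_tableau : Prop :=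
  [/\ forall i j : 'I_s, (i <= j)%N -> tab_a tab i j = 0,
      forall i : 'I_s, tab_c tab i = \sum_(j < s | (j < i)%N) tab_a tab i j
    & forall i : 'I_s, 0 <= tab_c tab i <= 1].

Definition quadrature_conditions (p : nat) : Prop :=
  \sum_(i < s) tab_b tab i = 1 /\
  forall k : nat, (1 <= k <= p.-1)%N ->
    \sum_(i < s) tab_b tab i * tab_c tab i ^+ k = (k.+1%:R)^-1.

Definition stage_increment (h : R) Fs (i : 'I_s) : 'M[R]_(m, n) :=
  h *: \sum_(j < s | (j < i)%N) tab_a tab i j *: Fs j.

Definition final_increment (h : R) Fs : 'M[R]_(m, n) :=
  h *: \sum_(i < s) tab_b tab i *: Fs i.

(* Stages are numbered from 0, so stage 0 is the first stage Y_{n,1} = Y_n.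
   Ys and Fs list the stage matrices Y_{n,i} and F_{n,i}. *)
Definition rk_step (tn h : R) Xn Ys Fs Xn1 : Prop :=
  [/\ forall i : 'I_s, i = 0%N :> nat ->
        Ys i = fmat Xn /\ Fs i = F tn (fmat Xn),
      forall i : 'I_s, (0 < i)%N ->
        (exists2 Xi : factors R m n r,
           kl_step Xn (stage_increment h Fs i) Xi & Ys i = fmat Xi) /\
        Fs i = F (tn + tab_c tab i * h) (Ys i)
    & kl_step Xn (final_increment h Fs) Xn1].

Definition rk_admissible (h : R) Xn Fs : Prop :=
  (forall i : 'I_s, (0 < i)%N -> kl_admissible Xn (stage_increment h Fs i)) /\
  kl_admissible Xn (final_increment h Fs).

Definition step_assumptions (p : nat) (Mp Cst eps tn h : R) (Yn : 'M[R]_(m, n))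
    Ys (An : R -> 'M[R]_(m, n)) : Prop :=
  let gn : R -> 'M[R]_(m, n) := fun t => F (tn + t) (An t) in
  [/\ solves_ivp (fun t => F (tn + t)) 0 h Yn An,
      Cp_on p [set` `[0, h]] gn,
      forall t, t \in `[0, h] ->
        frob (derive_within_n [set` `[0, h]] p gn t) <= Mp
    & forall i : 'I_s, tab_b tab i != 0 ->
        frob (Ys i - An (tab_c tab i * h)) <= Cst * (h ^+ p + h * eps)].

End RungeKutta.

(* Main.v *)
Require Import Defs.
From HB Require Import structures.
From mathcomp Require Import all_boot all_order all_algebra.
From mathcomp Require Import all_classical all_reals all_analysis.
From mathcomp Require Import ring lra.

Set Implicit Arguments.
Unset Strict Implicit.
Unset Printing Implicit Defensive.

Import Order.TTheory GRing.Theory Num.Theory.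
Import numFieldNormedType.Exports.

Local Open Scope classical_set_scope.
Local Open Scope ring_scope.

(** Put Z = Y_n + Delta A_n and let P be the orthogonal projector onto the range
    of K_1 = Z V_0.  A reduced K-L step returns Y_1 = P Z, so its error splits
    into d_n = |Z - A_n(h)| and the projection error |(I - P) Z|.  The quantity
    d_n is a quadrature error ([increment_error]): replacing F_{n,i} by
    g_n(c_i h) costs a Lipschitz term, and the remainder is of order h^(p+1) by
    Taylor expansion ([quadrature_error]).

    The projection error is where small singular values could hurt.  By
    construction (I - P) Z V_0 = 0, so it suffices to find an n x r matrix W,
    bounded independently of the singular values, such that A_n(h) is within
    O(h eps_r) of A_n(h) V_0 W^T: multiplying by I - V_0 W^T then bounds
    (I - P) Z by that distance and |Z - A_n(h)| ([range_projection_error]).  In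
    other words, the row space of the exact flow may turn by only a bounded
    angle during one step, up to an error O(h eps_r) in the matrix.

    Such a W(s) is transported along the flow with W^T V_0 = I.  Write K = A V_0,
    Y = K W^T and G = F(Y) (I - V_0 W^T).  The defect A - K W^T stays small if
    K W'^T is close to G, while W stays bounded if W'^T is not too large.  Small
    singular values of K are harmless because the normal-defect bound holds at
    every rank-r matrix: removing a direction u from the range of Y changes Y by
    at most |W| |K^T u|, and at the smaller matrix u may be taken normal, since
    r < m and r < n.  Hence
      |u^T F(Y) x| <= |x| (eps_r |u| + L |W| |K^T u|) whenever W^T x = 0
    ([near_tangent], [near_tangentP]): F can move a singular direction only at a
    speed proportional to its singular value, up to eps_r.  A Tikhonov-regularized
    least-squares solution X of K X = G with parameter l then satisfies
    |G - K X| = O(eps_r + l) and |X| = O(eps_r / l + 1)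
    ([regularized_least_squares]).  With l of order h eps_r the residual is
    O(eps_r) and |X| is at most 1 / h, so W moves by at most 1 over a step; this
    needs h L to be small, which is what fixes h_*.  Instead of solving the
    differential equation W'^T = X, an Euler scheme on a fine grid is used
    ([euler_row_space]); its consistency error, and the regularization needed
    when eps_r = 0, are absorbed in an arbitrary d > 0
    ([row_space_along_flow]).

    Globally, two exact solutions separate by at most a factor exp(L h) per step
    ([flow_stability]), and the local errors sum up as usual
    ([error_recursion]). *)

(** * The Frobenius norm and its inner product *)

Section Frobenius.
Variable R : realType.

Definition mxdot m n (A B : 'M[R]_(m, n)) : R :=
  \sum_i \sum_j A i j * B i j.

Lemma mxdotC m n (A B : 'M[R]_(m, n)) : mxdot A B = mxdot B A.
Proof. by apply: eq_bigr => i _; apply: eq_bigr => j _; rewrite mulrC. Qed.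

Lemma mxdotDr m n (A B C : 'M[R]_(m, n)) :
  mxdot A (B + C) = mxdot A B + mxdot A C.
Proof.
rewrite -big_split; apply: eq_bigr => i _.
by rewrite -big_split; apply: eq_bigr => j _; rewrite mxE mulrDr.
Qed.

Lemma mxdotZr m n a (A B : 'M[R]_(m, n)) : mxdot A (a *: B) = a * mxdot A B.
Proof.
rewrite mulr_sumr; apply: eq_bigr => i _.
by rewrite mulr_sumr; apply: eq_bigr => j _; rewrite mxE mulrCA.
Qed.

Lemma mxdotNr m n (A B : 'M[R]_(m, n)) : mxdot A (- B) = - mxdot A B.
Proof. by rewrite -scaleN1r mxdotZr mulN1r. Qed.

Lemma mxdotBr m n (A B C : 'M[R]_(m, n)) :
  mxdot A (B - C) = mxdot A B - mxdot A C.
Proof. by rewrite mxdotDr mxdotNr. Qed.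

Lemma mxdotZl m n a (A B : 'M[R]_(m, n)) : mxdot (a *: A) B = a * mxdot A B.
Proof. by rewrite mxdotC mxdotZr mxdotC. Qed.

Lemma mxdotBl m n (A B C : 'M[R]_(m, n)) :
  mxdot (A - B) C = mxdot A C - mxdot B C.
Proof. by rewrite mxdotC mxdotBr !(mxdotC C). Qed.

Lemma mxdot_tr m n (A B : 'M[R]_(m, n)) : mxdot A B = \tr (A^T *m B).
Proof.
rewrite /mxdot exchange_big /=; apply: eq_bigr => j _.
by rewrite mxE; apply: eq_bigr => i _; rewrite mxE.
Qed.

Lemma mxdot_mull m n k (A : 'M[R]_(m, n)) (K : 'M[R]_(m, k)) (X : 'M[R]_(k, n)) :
  mxdot A (K *m X) = mxdot (K^T *m A) X.
Proof. by rewrite !mxdot_tr trmx_mul trmxK mulmxA. Qed.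

Lemma mxdot_col m n (A B : 'M[R]_(m, n)) :
  mxdot A B = \sum_j mxdot (col j A) (col j B).
Proof.
rewrite /mxdot exchange_big; apply: eq_bigr => j _; apply: eq_bigr => i _.
by rewrite big_ord1 !mxE.
Qed.

Lemma mxdot_ge0 m n (A : 'M[R]_(m, n)) : 0 <= mxdot A A.
Proof. by apply: sumr_ge0 => i _; apply: sumr_ge0 => j _; rewrite -expr2 sqr_ge0. Qed.

Lemma frobE m n (A : 'M[R]_(m, n)) : frob A = Num.sqrt (mxdot A A).
Proof. by congr Num.sqrt; do 2![apply: eq_bigr => ? _]; rewrite expr2. Qed.

Lemma frob_ge0 m n (A : 'M[R]_(m, n)) : 0 <= frob A.
Proof. exact: sqrtr_ge0. Qed.

Lemma frob_sqr m n (A : 'M[R]_(m, n)) : frob A ^+ 2 = mxdot A A.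
Proof. by rewrite frobE sqr_sqrtr// mxdot_ge0. Qed.

Lemma frob_le m n (A : 'M[R]_(m, n)) b :
  0 <= b -> mxdot A A <= b ^+ 2 -> frob A <= b.
Proof. by move=> b0 Ab; rewrite -(ler_pXn2r (ltn0Sn 1)) ?nnegrE ?frob_ge0// frob_sqr. Qed.

Lemma frob_eq0 m n (A : 'M[R]_(m, n)) : frob A = 0 -> A = 0.
Proof.
move=> A0; have: mxdot A A == 0 by rewrite -frob_sqr A0 expr0n.
rewrite psumr_eq0 => [/allP Ai|i _]; last first.
  by apply: sumr_ge0 => j _; rewrite -expr2 sqr_ge0.
apply/matrixP => i j; have := Ai i (mem_index_enum _).
rewrite /= psumr_eq0 => [/allP Aij|k _]; last by rewrite -expr2 sqr_ge0.
by have := Aij j (mem_index_enum _); rewrite /= mulf_eq0 orbb mxE => /eqP.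
Qed.

Lemma frob_gt0 m n (A : 'M[R]_(m, n)) : A != 0 -> 0 < frob A.
Proof.
move=> A0; rewrite lt_neqAle frob_ge0 andbT eq_sym.
by apply: contra A0 => /eqP/frob_eq0/eqP.
Qed.

Lemma frob0 m n : frob (0 : 'M[R]_(m, n)) = 0.
Proof. by rewrite frobE /mxdot big1 ?sqrtr0// => i _; rewrite big1// => j _; rewrite mxE mul0r. Qed.

Lemma mxdot_le m n (A B : 'M[R]_(m, n)) : `|mxdot A B| <= frob A * frob B.
Proof.
have [->|B0] := eqVneq B 0.
  by rewrite frob0 mulr0 -(scale0r B) mxdotZr mul0r normr0.
have b0 : 0 < frob B ^+ 2 by rewrite exprn_gt0// frob_gt0.
rewrite -(ler_pXn2r (ltn0Sn 1)) ?nnegrE ?mulr_ge0 ?frob_ge0//.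
rewrite real_normK ?num_real// exprMn -subr_ge0 -(pmulr_rge0 _ b0).
have := mxdot_ge0 (frob B ^+ 2 *: A - mxdot A B *: B).
rewrite mxdotBr !mxdotBl !mxdotZr !mxdotZl -!frob_sqr (mxdotC B A).
by congr (0 <= _); ring.
Qed.

Lemma frobD m n (A B : 'M[R]_(m, n)) : frob (A + B) <= frob A + frob B.
Proof.
apply: frob_le; first by rewrite addr_ge0 ?frob_ge0.
rewrite mxdotDr !(mxdotC (A + B)) !mxdotDr -!frob_sqr (mxdotC B A).
have := le_trans (ler_norm _) (mxdot_le A B).
by rewrite sqrrD; move: (frob A) (frob B) (mxdot A B) => a b c; lra.
Qed.

Lemma frobZ m n a (A : 'M[R]_(m, n)) : frob (a *: A) = `|a| * frob A.
Proof.
by rewrite !frobE mxdotZr mxdotZl mulrA -expr2 sqrtrM ?sqr_ge0// sqrtr_sqr.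
Qed.

Lemma frobN m n (A : 'M[R]_(m, n)) : frob (- A) = frob A.
Proof. by rewrite -scaleN1r frobZ normrN1 mul1r. Qed.

Lemma frobB m n (A B : 'M[R]_(m, n)) : frob (A - B) <= frob A + frob B.
Proof. by rewrite (le_trans (frobD _ _))// frobN. Qed.

Lemma frob_sum m n (I : Type) (r : seq I) (P : pred I) (A : I -> 'M[R]_(m, n)) :
  frob (\sum_(i <- r | P i) A i) <= \sum_(i <- r | P i) frob (A i).
Proof.
elim/big_rec2: _ => [|i y x _ xy]; first by rewrite frob0.
by rewrite (le_trans (frobD _ _))// lerD2l.
Qed.

Lemma frob_trmx m n (A : 'M[R]_(m, n)) : frob A^T = frob A.
Proof. by rewrite !frobE !mxdot_tr trmxK mxtrace_mulC. Qed.

Lemma sqr_frob_col m n (A : 'M[R]_(m, n)) :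
  frob A ^+ 2 = \sum_j frob (col j A) ^+ 2.
Proof. by rewrite frob_sqr mxdot_col; apply: eq_bigr => j _; rewrite frob_sqr. Qed.

Lemma frob_col m n (A : 'M[R]_(m, n)) j : frob (col j A) <= frob A.
Proof.
apply: frob_le; first exact: frob_ge0.
rewrite sqr_frob_col (bigD1 j)//= -frob_sqr lerDl.
by apply: sumr_ge0 => k _; rewrite sqr_ge0.
Qed.

Lemma frobM m n k (A : 'M[R]_(m, n)) (B : 'M[R]_(n, k)) :
  frob (A *m B) <= frob A * frob B.
Proof.
apply: frob_le; first by rewrite mulr_ge0 ?frob_ge0.
rewrite exprMn -(frob_trmx A) !sqr_frob_col /mxdot mulr_suml.
apply: ler_sum => i _; rewrite mulr_sumr; apply: ler_sum => j _.
have -> : (A *m B) i j = mxdot (col i A^T) (col j B).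
  rewrite mxE /mxdot; apply: eq_bigr => l _.
  by rewrite big_ord1 !mxE.
rewrite -expr2 -exprMn -real_normK ?num_real//.
by rewrite lerXn2r ?nnegrE ?mulr_ge0 ?frob_ge0// mxdot_le.
Qed.

Lemma mxdot_mul_le p q (u : 'cV[R]_p) (A : 'M[R]_(p, q)) (x : 'cV[R]_q) :
  `|mxdot u (A *m x)| <= frob u * frob A * frob x.
Proof.
by rewrite (le_trans (mxdot_le _ _))// -mulrA ler_wpM2l ?frob_ge0 ?frobM.
Qed.

Lemma frob_entry m n (A : 'M[R]_(m, n)) i j : `|A i j| <= frob A.
Proof.
rewrite -(ler_pXn2r (ltn0Sn 1)) ?nnegrE ?frob_ge0// real_normK ?num_real//.
rewrite frob_sqr /mxdot (bigD1 i)//= (bigD1 j)//= -expr2 -addrA lerDl.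
rewrite addr_ge0 ?sumr_ge0// => [k _|k _]; first by rewrite -expr2 sqr_ge0.
by apply: sumr_ge0 => l _; rewrite -expr2 sqr_ge0.
Qed.

(** The constant is crude, but it depends on the dimensions only. *)
Lemma frob_le_entries m n (A : 'M[R]_(m, n)) b : 0 <= b ->
  (forall i j, `|A i j| <= b) -> frob A <= (m * n)%:R * b.
Proof.
move=> b0 Ab; apply: frob_le; first by rewrite mulr_ge0.
apply: (@le_trans _ _ ((m * n)%:R * b ^+ 2)); last first.
  rewrite exprMn ler_wpM2r ?sqr_ge0// -natrX ler_nat.
  by case: (m * n)%N => // k; rewrite expnS leq_pmulr.
apply: (@le_trans _ _ (\sum_(i < m) \sum_(j < n) b ^+ 2)).
  apply: ler_sum => i _; apply: ler_sum => j _.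
  by rewrite -expr2 -real_normK ?num_real// lerXn2r ?nnegrE.
by rewrite !sumr_const !card_ord -mulrnA mulr_natl mulnC.
Qed.

Lemma frob_scalar1 n : frob (1%:M : 'M[R]_n) = Num.sqrt n%:R.
Proof.
by rewrite frobE mxdot_tr trmx1 mul1mx mxtrace1.
Qed.

Lemma frob_orthonormal n r (Q : 'M[R]_(n, r)) :
  orthonormal_cols Q -> frob Q = Num.sqrt r%:R.
Proof. by move=> QQ; rewrite frobE mxdot_tr QQ mxtrace1. Qed.

End Frobenius.

(** * Low-rank matrices and the normal defect *)

Section Defect.
Variable R : realType.

Lemma exists_orthogonal_unit k j (u : 'cV[R]_k) (Q : 'M[R]_(k, j)) :
  (j.+1 < k)%N ->
  exists q : 'cV[R]_k, [/\ q^T *m q = 1%:M, Q^T *m q = 0 & u^T *m q = 0].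
Proof.
move=> jk; pose M := row_mx u Q.
have : kermx M != 0.
  rewrite -mxrank_eq0 mxrank_ker -lt0n subn_gt0.
  by apply: leq_ltn_trans (rank_leq_col _) _; rewrite add1n.
move=> /rowV0Pn[y /sub_kermxP yM y0].
have f0 : 0 < frob y by exact: frob_gt0.
have := yM; rewrite mul_mx_row -(row_mx0 _ 1 1 j) => /eq_row_mx[yu yQ].
exists ((frob y)^-1 *: y^T); split.
- rewrite [(_ *: _)^T]linearZ /= trmxK -scalemxAl -scalemxAr scalerA.
  have -> : y *m y^T = (frob y ^+ 2)%:M.
    by rewrite [LHS]mx11_scalar -frob_trmx frob_sqr mxdot_tr trmxK /mxtrace big_ord1.
  by rewrite scale_scalar_mx -invfM -expr2 mulVf// expf_neq0// gt_eqF.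
- by rewrite -scalemxAr -[Q^T *m _]trmxK trmx_mul !trmxK yQ trmx0 scaler0.
- by rewrite -scalemxAr -[u^T *m _]trmxK trmx_mul !trmxK yu trmx0 scaler0.
Qed.

(** Gram-Schmidt inside the hyperplane orthogonal to u.  A dependent column adds
    no direction of its own and is replaced by a fresh unit vector, which exists
    because u and the columns found so far cannot span the whole space when
    j < k. *)
Lemma orthonormal_basis_in_complement k j (u : 'cV[R]_k) (K : 'M[R]_(k, j)) :
  (j < k)%N -> u^T *m K = 0 ->
  exists Q : 'M[R]_(k, j), exists C : 'M[R]_j,
    [/\ orthonormal_cols Q, u^T *m Q = 0 & K = Q *m C].
Proof.
elim: j K => [|j IH] K jk uK.
  exists K, 1%:M; rewrite mulmx1; split=> //.
  by apply/matrixP => -[].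
pose K1 : 'cV[R]_k := @lsubmx _ k 1 j K.
pose K2 : 'M[R]_(k, j) := @rsubmx _ k 1 j K.
have KE : K = row_mx K1 K2 by rewrite hsubmxK.
have /eq_row_mx[uK1 uK2] : row_mx (u^T *m K1) (u^T *m K2) = row_mx 0 0.
  by rewrite row_mx0 -mul_mx_row -KE.
have [Q [C [QQ uQ K2E]]] := IH K2 (ltnW jk) uK2.
have [q [a [qq Qq uq wE]]] : exists q : 'cV[R]_k, exists a : R,
    [/\ q^T *m q = 1%:M, Q^T *m q = 0, u^T *m q = 0
      & K1 - Q *m (Q^T *m K1) = a *: q].
  set w := K1 - _.
  have Qw : Q^T *m w = 0 by rewrite mulmxBr [Q^T *m (Q *m _)]mulmxA QQ mul1mx subrr.
  have uw : u^T *m w = 0 by rewrite mulmxBr uK1 [u^T *m (Q *m _)]mulmxA uQ mul0mx subr0.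
  have [w0|w0] := eqVneq w 0.
    have [q [qq Qq uq]] := exists_orthogonal_unit u Q jk.
    by exists q, 0; rewrite scale0r.
  have f0 : frob w != 0 by rewrite gt_eqF// frob_gt0.
  exists ((frob w)^-1 *: w), (frob w); split.
  - rewrite [(_ *: _)^T]linearZ /= -scalemxAl -scalemxAr scalerA.
    have -> : w^T *m w = (frob w ^+ 2)%:M.
      by rewrite [LHS]mx11_scalar frob_sqr mxdot_tr /mxtrace big_ord1.
    by rewrite scale_scalar_mx -invfM -expr2 mulVf// expf_neq0.
  - by rewrite -scalemxAr Qw scaler0.
  - by rewrite -scalemxAr uw scaler0.
  - by rewrite scalerA mulfV// scale1r.
exists (row_mx q Q), (block_mx a%:M 0 (Q^T *m K1) C); split.
- change ((row_mx q Q)^T *m row_mx q Q = 1%:M :> 'M[R]_(1 + j)).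
  rewrite tr_row_mx mul_col_row qq Qq QQ.
  have -> : q^T *m Q = 0 by rewrite -[LHS]trmxK trmx_mul trmxK Qq trmx0.
  by rewrite -scalar_mx_block.
- have E : u^T *m row_mx q Q = 0 by rewrite mul_mx_row uq uQ row_mx0.
  exact: E.
- change (K = row_mx q Q *m block_mx a%:M 0 (Q^T *m K1) C :> 'M[R]_(k, 1 + j)).
  rewrite KE mul_row_block mulmx0 add0r -K2E mul_mx_scalar -wE.
  by rewrite subrK.
Qed.

(** Among r+1 distinct shifts one avoids the at most r eigenvalues of - S. *)
Lemma exists_unitmx_shift r (S : 'M[R]_r) (d : R) : 0 < d ->
  exists2 x, 0 < x <= d & S + x%:M \in unitmx.
Proof.
move=> d0; apply: contrapT => noS.
pose xs := [seq d / i.+1%:R | i <- iota 0 r.+1].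
have xsr : all (root (char_poly (- S))) xs.
  apply/allP => _ /mapP[i _ ->]; rewrite -eigenvalue_root_char.
  apply: contrapT => /negP Ne; apply: noS; exists (d / i.+1%:R).
    by rewrite divr_gt0// ler_pdivrMr// ler_peMr ?ler1n ?(ltW d0).
  have -> : S + (d / i.+1%:R)%:M = - (- S - (d / i.+1%:R)%:M).
    by rewrite opprB opprK addrC.
  rewrite -scaleN1r unitmxZ ?unitrN1//.
  move: Ne; rewrite /eigenvalue /eigenspace negbK.
  by rewrite kermx_eq0 -row_free_unit.
have uxs : uniq xs.
  rewrite map_inj_uniq ?iota_uniq// => i j /(mulfI (lt0r_neq0 d0)) /invr_inj.
  by move=> /eqP; rewrite eqr_nat => /eqP[].
have char0 : char_poly (- S) != 0 by rewrite monic_neq0// char_poly_monic.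
have := max_poly_roots char0 xsr uxs.
by rewrite size_map size_iota size_char_poly ltnn.
Qed.

End Defect.

Section NearTangent.
Variables (R : realType) (m n r : nat).

(** The normal-defect bound in a form insensitive to the singular values of K:
    in the direction u the field has a component leaving the row space of W that
    is at most proportional to the size of K in that direction, up to e. *)
Definition near_tangent (e L : R) (G : 'M[R]_(m, n) -> 'M[R]_(m, n)) : Prop :=
  forall (K : 'M[R]_(m, r)) (W : 'M[R]_(n, r)) (u : 'cV[R]_m) (x : 'cV[R]_n),
    W^T *m x = 0 ->
    `|mxdot u (G (K *m W^T) *m x)|
      <= frob x * (e * frob u + L * frob W * frob (K^T *m u)).

Variables (e L : R) (G : 'M[R]_(m, n) -> 'M[R]_(m, n)).
Hypotheses (rm : (r < m)%N) (rn : (r < n)%N) (L0 : 0 <= L).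
Hypothesis G_lip : forall Y Z, frob (G Y - G Z) <= L * frob (Y - Z).
Hypothesis G_defect : forall X : factors R m n r, rank_r_factors X ->
  frob ((1%:M - facU X *m (facU X)^T) *m G (fmat X)
          *m (1%:M - facV X *m (facV X)^T)) <= e.

(** The normal-defect bound survives at matrices of rank below r: u and x can
    still be chosen normal to orthonormal frames U and V of r columns containing
    the range and the row space, and the r x r core is perturbed into an
    invertible one.  The Lipschitz bound lets the perturbation tend to 0. *)
Lemma defect_low_rank (K : 'M[R]_(m, r)) (W : 'M[R]_(n, r))
    (u : 'cV[R]_m) (x : 'cV[R]_n) :
  u^T *m K = 0 -> x^T *m W = 0 ->
  `|mxdot u (G (K *m W^T) *m x)| <= e * frob u * frob x.
Proof.
move=> uK xW.
have [U [C [UU uU KE]]] := orthonormal_basis_in_complement rm uK.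
have [V [D [VV xV WE]]] := orthonormal_basis_in_complement rn xW.
apply/ler_addgt0Pr => t t0.
pose a := frob u * L * (Num.sqrt r%:R * Num.sqrt r%:R) * frob x.
have a0 : 0 <= a by rewrite !mulr_ge0 ?frob_ge0 ?sqrtr_ge0.
have [d /andP[d0 dt] Sd] :=
  exists_unitmx_shift (C *m D^T) (divr_gt0 t0 (ltr_pwDr ltr01 a0)).
pose X := Factors U (C *m D^T + d%:M) V.
have rX : rank_r_factors X by split.
have YE : fmat X = K *m W^T + d *: (U *m V^T).
  rewrite /fmat /= mulmxDr mulmxDl KE WE trmx_mul !mulmxA; congr (_ + _).
  by rewrite mul_mx_scalar -scalemxAl.
have uP : (1%:M - U *m U^T) *m u = u.
  rewrite mulmxBl mul1mx -mulmxA -[U^T *m u]trmxK trmx_mul trmxK uU.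
  by rewrite trmx0 mulmx0 subr0.
have xP : (1%:M - V *m V^T) *m x = x.
  rewrite mulmxBl mul1mx -mulmxA -[V^T *m x]trmxK trmx_mul trmxK xV.
  by rewrite trmx0 mulmx0 subr0.
have sP : (1%:M - U *m U^T)^T = 1%:M - U *m U^T.
  by rewrite linearB /= trmx1 trmx_mul trmxK.
have main : `|mxdot u (G (fmat X) *m x)| <= e * frob u * frob x.
  rewrite -{1}uP -{1}xP -{1}sP -mxdot_mull !mulmxA.
  rewrite (le_trans (mxdot_mul_le _ _ _))// ler_wpM2r ?frob_ge0//.
  rewrite (mulrC e); apply: ler_wpM2l; first exact: frob_ge0.
  exact: G_defect rX.
have -> : G (K *m W^T) = G (fmat X) + (G (K *m W^T) - G (fmat X)).
  by rewrite addrC subrK.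
rewrite mulmxDl mxdotDr (le_trans (ler_normD _ _))// lerD//.
rewrite (le_trans (mxdot_mul_le _ _ _))//.
apply: (@le_trans _ _ (a * d)); last first.
  move: dt; rewrite ler_pdivlMr ?ltr_pwDr//; apply: le_trans.
  by rewrite mulrDr mulr1 mulrC lerDl ltW.
rewrite [leRHS](_ : _ = frob u * (L * (d * (Num.sqrt r%:R * Num.sqrt r%:R)))
    * frob x); last by rewrite /a; ring.
rewrite ler_wpM2r ?frob_ge0// ler_wpM2l ?frob_ge0//.
rewrite (le_trans (G_lip _ _))// ler_wpM2l// YE opprD addNKr frobN frobZ.
rewrite gtr0_norm// ler_pM2l// (le_trans (frobM _ _))//.
by rewrite frob_trmx !frob_orthonormal.
Qed.

(** Removing the component along u from K puts u in the normal space, where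
    [defect_low_rank] applies; the Lipschitz bound pays for the removal. *)
Lemma near_tangentP : 0 <= e -> near_tangent e L G.
Proof.
move=> e0 K W u x Wx.
have xW : x^T *m W = 0 by rewrite -[LHS]trmxK trmx_mul trmxK Wx trmx0.
have [->|u0] := eqVneq u 0.
  rewrite -{1}(scale0r (0 : 'cV[R]_m)) mxdotZl mul0r normr0.
  by rewrite !(mulr_ge0, addr_ge0, frob_ge0).
have fu : 0 < frob u by exact: frob_gt0.
pose a := (frob u ^+ 2)^-1.
pose K' := K - a *: (u *m (u^T *m K)).
have uu : u^T *m u = (frob u ^+ 2)%:M.
  by rewrite [LHS]mx11_scalar frob_sqr mxdot_tr /mxtrace big_ord1.
have uK' : u^T *m K' = 0.
  rewrite /K' mulmxBr -scalemxAr [u^T *m (u *m _)]mulmxA uu mul_scalar_mx scalerA.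
  by rewrite mulVf ?scale1r ?subrr// expf_neq0// gt_eqF.
have -> : G (K *m W^T) = G (K' *m W^T) + (G (K *m W^T) - G (K' *m W^T)).
  by rewrite addrC subrK.
rewrite mulmxDl mxdotDr (le_trans (ler_normD _ _))// mulrDr lerD//.
  rewrite (le_trans (defect_low_rank uK' xW))//.
  by rewrite mulrC.
rewrite (le_trans (mxdot_mul_le _ _ _))// [leRHS]mulrC ler_wpM2r ?frob_ge0//.
have fa : frob (K *m W^T - K' *m W^T) <= (frob u)^-1 * frob (K^T *m u) * frob W.
  rewrite -mulmxBl (le_trans (frobM _ _))// frob_trmx ler_wpM2r ?frob_ge0//.
  rewrite /K' opprB addrC subrK frobZ ger0_norm ?invr_ge0 ?exprn_ge0 ?frob_ge0//.
  rewrite -[X in _ <= _ * X]frob_trmx trmx_mul trmxK.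
  rewrite ler_pdivrMl ?exprn_gt0// (le_trans (frobM _ _))//.
  by rewrite expr2 mulrA mulfK ?gt_eqF.
rewrite -ler_pdivlMl// (le_trans (G_lip _ _))//.
apply: le_trans (ler_wpM2l L0 fa) _.
by rewrite le_eqVlt; apply/orP; left; apply/eqP; ring.
Qed.

End NearTangent.

(** * Regularized least squares *)

Section LeastSquares.
Variable R : realType.

Lemma le_add_of_sqr_le (a b e d : R) : 0 <= a -> 0 <= b -> 0 <= e -> 0 <= d ->
  a ^+ 2 + b ^+ 2 <= e * a + d * b -> a <= e + d /\ b <= e + d.
Proof.
wlog ba : a b e d / b <= a => [hwlog a0 b0 e0 d0 H|a0 b0 e0 d0 H].
  have [ba|/ltW ab] := leP b a; first exact: hwlog.
  have [] := hwlog b a d e ab b0 a0 d0 e0; first by rewrite addrC (addrC (d * b)).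
  by rewrite (addrC d).
have ae : a <= e + d.
  rewrite leNgt; apply/negP => lt.
  have a1 : 0 < a by apply: le_lt_trans lt; rewrite addr_ge0.
  have : a * (e + d) < a * a by rewrite ltr_pM2l.
  have := ler_wpM2l d0 ba; have := sqr_ge0 b.
  by move: H; rewrite !expr2; lra.
by split; last exact: le_trans ae.
Qed.

(** X is the Tikhonov solution, whose residual S = G - K X satisfies
    K^T S = l^2 X.  Testing the hypothesis on S gives
    |S|^2 + l^2 |X|^2 = <S, G> <= e |S| + c l^2 |X|,
    so no spectral decomposition of K enters.  The last conclusion keeps
    W^T V_0 = I along the Euler scheme. *)
Lemma regularized_least_squares m n r (K : 'M[R]_(m, r)) (G : 'M[R]_(m, n))
    (l e c : R) :
  0 < l -> 0 <= e -> 0 <= c ->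
  (forall U, `|mxdot U G| <= e * frob U + c * frob (K^T *m U)) ->
  exists X : 'M[R]_(r, n),
    [/\ frob (G - K *m X) <= e + c * l, frob X <= e / l + c
      & forall p (V : 'M[R]_(n, p)), G *m V = 0 -> X *m V = 0].
Proof.
move=> l0 e0 c0 HG; pose N := K^T *m K + (l ^+ 2)%:M.
have NU : N \in unitmx.
  rewrite -row_free_unit -kermx_eq0; apply/rowV0P => v /sub_kermxP vN.
  have : (v *m N) *m v^T = 0 by rewrite vN mul0mx.
  move=> /(congr1 mxtrace); rewrite mxtrace0 /N mulmxDr mul_mx_scalar mulmxDl.
  rewrite -scalemxAl mxtraceD mxtraceZ => /eqP.
  have -> : v *m (K^T *m K) *m v^T = (K *m v^T)^T *m (K *m v^T).
    by rewrite trmx_mul trmxK !mulmxA.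
  have -> : v *m v^T = v^T^T *m v^T by rewrite trmxK.
  rewrite -!mxdot_tr paddr_eq0 ?(mulr_ge0 (sqr_ge0 _)) ?mxdot_ge0//.
  move=> /andP[_]; rewrite mulf_eq0 expf_eq0/= (gt_eqF l0)/= -frob_sqr expf_eq0/=.
  by move=> /eqP/frob_eq0 v0; rewrite -[v]trmxK v0 trmx0.
pose X := invmx N *m (K^T *m G).
have KR : K^T *m (G - K *m X) = l ^+ 2 *: X.
  have : N *m X = K^T *m G by rewrite /X mulKVmx.
  by rewrite /N mulmxDl mul_scalar_mx -mulmxA mulmxBr => <-; rewrite addrC addKr.
(* The two squares add up to the inner product of the residual with G. *)
have bound : frob (G - K *m X) ^+ 2 + (l * frob X) ^+ 2
    <= e * frob (G - K *m X) + c * l * (l * frob X).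
  have -> : frob (G - K *m X) ^+ 2 + (l * frob X) ^+ 2 = mxdot (G - K *m X) G.
    rewrite -[X in mxdot _ X](subrK (K *m X)) mxdotDr mxdot_mull KR mxdotZl.
    by rewrite exprMn !frob_sqr.
  rewrite (le_trans (ler_norm _))// (le_trans (HG _))// KR frobZ.
  by rewrite ger0_norm ?sqr_ge0// lerD2l expr2 !mulrA.
have [ha hb] : frob (G - K *m X) <= e + c * l /\ l * frob X <= e + c * l.
  have b0 : 0 <= l * frob X by rewrite mulr_ge0 ?frob_ge0// ltW.
  have d0 : 0 <= c * l by rewrite mulr_ge0// ltW.
  exact: le_add_of_sqr_le (frob_ge0 _) b0 e0 d0 bound.
exists X; split=> //.
- by rewrite -(ler_pM2l l0) mulrDr (mulrC e) mulrA mulfV ?gt_eqF// mul1r (mulrC l c).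
- by move=> p V GV; rewrite /X -!mulmxA GV !mulmx0.
Qed.

End LeastSquares.

(** * A well-conditioned row space along the flow *)

Section RowSpace.
Variables (R : realType) (m n r : nat).

(** The bilinear bound summed over the columns of M and U; this is the form that
    [regularized_least_squares] asks for. *)
Lemma near_tangent_mx (e L : R) (G : 'M[R]_(m, n) -> 'M[R]_(m, n))
    (K : 'M[R]_(m, r)) (W : 'M[R]_(n, r)) (M : 'M[R]_n) (U : 'M[R]_(m, n)) :
  0 <= e -> 0 <= L -> near_tangent r e L G -> W^T *m M = 0 ->
  `|mxdot U (G (K *m W^T) *m M)|
    <= n%:R * frob M * (e * frob U + L * frob W * frob (K^T *m U)).
Proof.
move=> e0 L0 GT WM.
rewrite mxdot_col (le_trans (ler_norm_sum _ _ _))//.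
rewrite -mulrA -[X in X%:R * _](card_ord n) mulr_natl -sumr_const.
apply: ler_sum => j _; rewrite [col j (_ *m M)]colE -mulmxA -colE.
have Wj : W^T *m col j M = 0 by rewrite colE mulmxA -colE WM col0.
apply: le_trans (GT K W (col j U) (col j M) Wj) _.
have LW : 0 <= L * frob W by rewrite mulr_ge0 ?frob_ge0.
apply: ler_pM; rewrite ?frob_ge0 ?frob_col ?addr_ge0 ?mulr_ge0 ?frob_ge0//.
rewrite lerD ?ler_wpM2l ?frob_col//.
by rewrite colE mulmxA -colE frob_col.
Qed.

(** One Euler step of the defect A (I - V W^T): A moves by t F + rho and V W^T by
    t V X.  The first-order terms are a Lipschitz difference of fields and a
    least-squares residual. *)
Lemma euler_error_expand (A F FY rho : 'M[R]_(m, n)) (P : 'M[R]_n)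
    (V : 'M[R]_(n, r)) (X : 'M[R]_(r, n)) (t : R) :
  (A + t *: F + rho) *m (P - t *: (V *m X))
  = A *m P + (t *: ((F - FY) *m P) + t *: (FY *m P - A *m V *m X)
     + rho *m (P - t *: (V *m X)) - t ^+ 2 *: (F *m V *m X)).
Proof.
rewrite !mulmxDl !mulmxDr !mulNmx !mulmxN -!scalemxAr -!scalemxAl !mulmxA.
by apply/matrixP => i j; rewrite !mxE; ring.
Qed.

Variables (V0 : 'M[R]_(n, r)) (V0o : orthonormal_cols V0).

Let w : R := Num.sqrt r%:R + 1.
Let q : R := Num.sqrt n%:R + Num.sqrt r%:R * w.

Lemma frob_oblique_complement (W : 'M[R]_(n, r)) :
  frob (W - V0) <= 1 -> frob W <= w /\ frob (1%:M - V0 *m W^T) <= q.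
Proof.
move=> WV.
have Ww : frob W <= w.
  rewrite -(subrK V0 W) (le_trans (frobD _ _))// addrC lerD//.
  by rewrite frob_orthonormal.
split=> //; rewrite (le_trans (frobB _ _))// frob_scalar1 lerD2l.
rewrite (le_trans (frobM _ _))// frob_orthonormal// frob_trmx.
by rewrite ler_wpM2l ?sqrtr_ge0.
Qed.

Variables (L B eps d h eta : R).
Hypotheses (n0 : (0 < n)%N) (L0 : 0 <= L) (eps0 : 0 <= eps) (d0 : 0 < d).
Hypotheses (h0 : 0 < h) (eta0 : 0 < eta).
Hypothesis hLw : h * (n%:R * q * (L * w)) <= 2^-1.
Hypothesis hLq : h * (L * q) <= 2^-1.
Hypothesis etaB : eta * (B * Num.sqrt r%:R) <= d * h.

Variables (A : nat -> 'M[R]_(m, n)) (G : nat -> 'M[R]_(m, n) -> 'M[R]_(m, n)).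
Hypothesis A0 : A 0%N *m V0 *m V0^T = A 0%N.
Hypothesis A_euler : forall k, k.+1%:R * eta <= h ->
  frob (A k.+1 - A k - eta *: G k (A k)) <= eta * d.
Hypothesis G_bounded : forall k Y, k.+1%:R * eta <= h -> frob (G k Y) <= B.
Hypothesis G_lip : forall k Y Z, k.+1%:R * eta <= h ->
  frob (G k Y - G k Z) <= L * frob (Y - Z).
Hypothesis G_tangent : forall k, k.+1%:R * eta <= h ->
  near_tangent r eps L (G k).

(** The Euler scheme W_{k+1}^T = W_k^T + eta X_k, with X_k the least-squares
    solution for the field at K W_k^T.  The regularization parameter 2 h e0 makes
    the part e0 / l of the bound on X_k equal to 1 / (2 h), while the residual is
    at most 2 e0.  The defect grows by at most eta (L q |defect| + b) per step;
    as h L q <= 1/2, the linear bound 2 k eta b is preserved. *)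
Lemma euler_row_space k : k%:R * eta <= h ->
  exists W : 'M[R]_(n, r),
    [/\ W^T *m V0 = 1%:M, frob (W - V0) <= k%:R * eta / h
      & frob (A k *m (1%:M - V0 *m W^T))
          <= 2 * (k%:R * eta) * (2 * (n%:R * q * (eps + d)) + (q + 1) * d)].
Proof.
set e0 := n%:R * q * (eps + d); set b := 2 * e0 + _.
have r0 : 0 <= Num.sqrt r%:R :> R by exact: sqrtr_ge0.
have w1 : 0 < w by rewrite /w ltr_wpDl.
have q0 : 0 < q by rewrite /q ltr_pwDl ?sqrtr_gt0 ?ltr0n// mulr_ge0// ltW.
have nR : 0 < n%:R :> R by rewrite ltr0n.
have e00 : 0 < e0 by rewrite !mulr_gt0// ltr_wpDl.
have b0 : 0 < b.
  by rewrite /b; apply: addr_gt0; apply: mulr_gt0; rewrite // addr_gt0.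
elim: k => [_|k IH kh].
  exists V0; split; first exact: V0o.
    by rewrite subrr frob0 mulr0n !mul0r.
  by rewrite mulmxBr mulmx1 mulmxA A0 subrr frob0 mulr0n mul0r mulr0 mul0r.
have kh' : k%:R * eta <= h.
  by rewrite (le_trans _ kh)// ler_wpM2r ?(ltW eta0)// ler_nat.
have [W [WV Wk Ek]] := IH kh'.
have W1 : frob (W - V0) <= 1.
  by rewrite (le_trans Wk)// ler_pdivrMr// mul1r.
have [Ww Pq] := frob_oblique_complement W1.
set P := 1%:M - V0 *m W^T in Pq Ek.
have PV : P *m V0 = 0 by rewrite mulmxBl mul1mx -mulmxA WV mulmx1 subrr.
have WP : W^T *m P = 0 by rewrite mulmxBr mulmx1 mulmxA WV mul1mx subrr.
pose K := A k *m V0; pose Y := K *m W^T.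
pose c0 := n%:R * q * (L * w).
have c00 : 0 <= c0.
  by apply: mulr_ge0; apply: mulr_ge0; rewrite ?(ltW q0) ?(ltW w1) ?ler0n.
have lsq U : `|mxdot U (G k Y *m P)| <= e0 * frob U + c0 * frob (K^T *m U).
  apply: le_trans (near_tangent_mx _ _ eps0 L0 (G_tangent kh) WP) _.
  have fU := frob_ge0 U; have fK := frob_ge0 (K^T *m U).
  rewrite /e0 /c0 -(mulrA _ (eps + d)) -(mulrA _ (L * w)) -mulrDr.
  apply: ler_pM.
  - by rewrite mulr_ge0 ?frob_ge0.
  - by rewrite addr_ge0// !mulr_ge0 ?frob_ge0.
  - by rewrite ler_wpM2l.
  - apply: lerD; first by rewrite ler_wpM2r// lerDl ltW.
    by rewrite ler_wpM2r// ler_wpM2l.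
have l0 : 0 < 2 * h * e0 by apply: mulr_gt0 => //; apply: mulr_gt0.
have [X [Rb Xb XV]] := regularized_least_squares l0 (ltW e00) c00 lsq.
have {}XV : X *m V0 = 0 by apply: XV; rewrite -mulmxA PV mulmx0.
have {}Rb : frob (G k Y *m P - K *m X) <= 2 * e0.
  apply: le_trans Rb _.
  have : c0 * h * e0 <= 2^-1 * e0 by rewrite ler_wpM2r ?(ltW e00)// mulrC.
  by move: (c0) (h) (e0) => x y z; lra.
have {}Xb : frob X <= h^-1.
  apply: le_trans Xb _.
  have -> : e0 / (2 * h * e0) = h^-1 / 2 by field; rewrite !gt_eqF.
  have : c0 <= h^-1 / 2 by rewrite mulrC ler_pdivlMr// mulrC.
  lra.
have etaX : frob (eta *: X) <= eta / h.
  by rewrite frobZ gtr0_norm// ler_pM2l.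
exists (W + eta *: X^T); split.
- rewrite linearD /= [(_ *: _)^T]linearZ /= trmxK mulmxDl WV -scalemxAl XV.
  by rewrite scaler0 addr0.
- rewrite addrAC (le_trans (frobD _ _))// -[k.+1]addn1 natrD mulrDl mulrDl.
  rewrite lerD// mul1r.
  by rewrite -[_ *: _]trmxK frob_trmx [(_ *: _)^T]linearZ /= trmxK.
have W'1 : frob (W + eta *: X^T - V0) <= 1.
  rewrite addrAC (le_trans (frobD _ _))//.
  apply: (@le_trans _ _ (k%:R * eta / h + eta / h)).
    rewrite lerD//.
    by rewrite -[_ *: _]trmxK frob_trmx [(_ *: _)^T]linearZ /= trmxK.
  rewrite -mulrDl ler_pdivrMr// mul1r (le_trans _ kh)//.
  by rewrite -[k.+1]addn1 natrD mulrDl mul1r.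
have [_] := frob_oblique_complement W'1.
have -> : (W + eta *: X^T)^T = W^T + eta *: X.
  by rewrite linearD /= [(_ *: _)^T]linearZ /= trmxK.
set P' := 1%:M - _ => P'q.
have P'E : P' = P - eta *: (V0 *m X).
  by rewrite /P' /P mulmxDr -scalemxAr opprD addrA.
pose rho := A k.+1 - A k - eta *: G k (A k).
have A'E : A k.+1 = A k + eta *: G k (A k) + rho.
  by apply/matrixP => i j; rewrite !mxE; ring.
have -> : A k.+1 *m P' = A k *m P + (eta *: ((G k (A k) - G k Y) *m P)
   + eta *: (G k Y *m P - K *m X) + rho *m P'
   - (eta ^+ 2) *: (G k (A k) *m V0 *m X)).
  by rewrite A'E P'E (euler_error_expand _ _ (G k Y)).
have EY : A k - Y = A k *m P by rewrite /Y /K /P mulmxBr mulmx1 mulmxA.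
have -> : 2 * (k.+1%:R * eta) * b = 2 * (k%:R * eta) * b + eta * (b + b).
  by rewrite -[k.+1]addn1 natrD; move: (b) => y; ring.
rewrite (le_trans (frobD _ _))// lerD//.
have T1 : frob (eta *: ((G k (A k) - G k Y) *m P)) <= eta * b.
  rewrite frobZ gtr0_norm// ler_wpM2l ?(ltW eta0)// (le_trans (frobM _ _))//.
  apply: (@le_trans _ _ (L * (2 * (k%:R * eta) * b) * q)).
    apply: ler_pM; rewrite ?frob_ge0//.
    by rewrite (le_trans (G_lip _ _ kh))// EY ler_wpM2l.
  have : (L * q) * (k%:R * eta) <= 2^-1.
    apply: le_trans hLq; rewrite mulrC ler_wpM2r ?mulr_ge0 ?(ltW q0)//.
  by move: b0; move: (k%:R * eta) (b) (L) (q) => x y z t y0 H; nra.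
have T2 : frob (eta *: (G k Y *m P - K *m X)) <= eta * (2 * e0).
  by rewrite frobZ gtr0_norm// ler_wpM2l ?(ltW eta0).
have T3 : frob (rho *m P') <= eta * (q * d).
  rewrite (le_trans (frobM _ _))// (mulrC q) mulrA.
  by apply: ler_pM; rewrite ?frob_ge0// A_euler.
have T4 : frob (eta ^+ 2 *: (G k (A k) *m V0 *m X)) <= eta * d.
  rewrite frobZ ger0_norm ?sqr_ge0// expr2 -mulrA ler_wpM2l ?(ltW eta0)//.
  apply: (@le_trans _ _ (eta * (B * Num.sqrt r%:R * h^-1))); last first.
    by rewrite mulrA ler_pdivrMr.
  rewrite ler_wpM2l ?(ltW eta0)// (le_trans (frobM _ _))//.
  apply: ler_pM; rewrite ?frob_ge0// (le_trans (frobM _ _))//.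
  by rewrite (frob_orthonormal V0o) ler_wpM2r// G_bounded.
rewrite (le_trans (frobB _ _))//.
apply: (@le_trans _ _ (eta * b + eta * (2 * e0) + eta * (q * d) + eta * d)).
  by do 2![rewrite lerD//; rewrite (le_trans (frobD _ _))//]; rewrite lerD.
rewrite -!mulrDr ler_wpM2l ?(ltW eta0)// -!addrA lerD2l /b.
by move: (e0) => x; lra.
Qed.

End RowSpace.

Section RangeProjection.
Variables (R : realType) (m n r : nat).

(** The projected matrix Q Z vanishes on V0, hence Q Z = Q Z (I - V0 W^T); the
    right-hand factor nearly annihilates A, and Z is close to A. *)
Lemma range_projection_error (Z A : 'M[R]_(m, n)) (V0 W : 'M[R]_(n, r))
    (U1 : 'M[R]_(m, r)) (S : 'M[R]_r) :
  orthonormal_cols V0 -> orthonormal_cols U1 -> U1 *m S = Z *m V0 ->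
  frob (W - V0) <= 1 ->
  frob (Z - U1 *m U1^T *m Z)
    <= (Num.sqrt m%:R + r%:R)
       * (frob (A *m (1%:M - V0 *m W^T))
          + (Num.sqrt n%:R + Num.sqrt r%:R * (Num.sqrt r%:R + 1))
            * frob (Z - A)).
Proof.
move=> V0o U1o US WV; have [_ Pq] := frob_oblique_complement V0o WV.
pose Q := 1%:M - U1 *m U1^T; pose P := 1%:M - V0 *m W^T.
have QZ : Q *m Z *m V0 = 0.
  by rewrite -mulmxA -US mulmxA mulmxBl mul1mx -mulmxA U1o mulmx1 subrr mul0mx.
have -> : Z - U1 *m U1^T *m Z = Q *m (A *m P + (Z - A) *m P).
  rewrite -mulmxDl [A + _]addrC subrK mulmxA {1}/P mulmxBr mulmx1 [_ *m (V0 *m _)]mulmxA QZ.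
  by rewrite mul0mx subr0 /Q mulmxBl mul1mx.
apply: le_trans (frobM _ _) _; apply: ler_pM; rewrite ?frob_ge0//.
  rewrite (le_trans (frobB _ _))// frob_scalar1 lerD2l (le_trans (frobM _ _))//.
  by rewrite frob_trmx frob_orthonormal// -expr2 sqr_sqrtr.
rewrite (le_trans (frobD _ _))// lerD2l (le_trans (frobM _ _))// mulrC.
by rewrite ler_wpM2r ?frob_ge0.
Qed.

End RangeProjection.

(** * Differentiation on a closed interval *)

Section Calculus.
Variable R : realType.
Implicit Types (f g df dg : R -> R) (a b t : R).

(** First-order expansion with one-sided increments at the endpoints, in a form
    that makes restriction and translation of the interval immediate. *)
Definition derives_on a b f df : Prop :=
  forall t, a <= t <= b -> forall e, 0 < e ->
  exists2 d, 0 < d & forall u, a <= u <= b -> `|u - t| < d ->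
    `|f u - f t - df t * (u - t)| <= e * `|u - t|.

Lemma derives_on_entry m n a b (f df : R -> 'M[R]_(m, n)) i j :
  (forall t, t \in `[a, b] -> is_derive_within [set` `[a, b]] f t (df t)) ->
  derives_on a b (fun t => f t i j) (fun t => df t i j).
Proof.
move=> fdf t tab e e0.
have tD : t \in `[a, b] by rewrite in_itv.
have lim := cvg_comp _ _ (fdf t tD) (@coord_continuous R m n i j (df t)).
have /cvgrPdist_le/(_ e e0) lim_e := lim.
have /nbhs_ballP[d /= d0 H] : nbhs t (fun u => u != t -> u \in `[a, b] ->
    `|df t i j - diff_quotient f t u i j| <= e) := lim_e.
exists d => // u uab ut.
have [->|neq] := eqVneq u t; first by rewrite !subrr mulr0 subr0 normr0 mulr0.
have := H u; rewrite /ball /= distrC => /(_ ut neq).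
rewrite in_itv /= => /(_ uab); rewrite /diff_quotient !mxE => Hu.
have ut0 : u - t != 0 by rewrite subr_eq0.
have -> : f u i j - f t i j - df t i j * (u - t)
    = - (df t i j - (u - t)^-1 * (f u i j - f t i j)) * (u - t).
  by field.
by rewrite normrM normrN ler_wpM2r.
Qed.

Lemma derives_on_sub a b c d f df : a <= c -> d <= b ->
  derives_on a b f df -> derives_on c d f df.
Proof.
move=> ac db H t /andP[ct td] e e0.
have [|r r0 Hr] := H t _ e e0; first by rewrite (le_trans ac)//= (le_trans td).
exists r => // u /andP[cu ud] ut; apply: Hr => //.
by rewrite (le_trans ac)//= (le_trans ud).
Qed.

Lemma derives_on_shift a b s f df :
  derives_on a b f df ->
  derives_on (a - s) (b - s) (fun t => f (s + t)) (fun t => df (s + t)).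
Proof.
move=> H t tab e e0.
have [|r r0 Hr] := H (s + t) _ e e0; first by rewrite -lerBlDl -[s + t <= b]lerBrDl.
exists r => // u uab ut.
have E : s + u - (s + t) = u - t by ring.
by rewrite -E; apply: Hr; rewrite ?E// -lerBlDl -[s + u <= b]lerBrDl.
Qed.

Lemma derives_on_cst a b (c : R) : derives_on a b (fun=> c) (fun=> 0).
Proof.
by move=> t _ e e0; exists 1 => // u _ _; rewrite subrr mul0r subr0 normr0 mulr_ge0 ?(ltW e0).
Qed.

Lemma derives_on_id a b : derives_on a b id (fun=> 1).
Proof.
by move=> t _ e e0; exists 1 => // u _ _; rewrite mul1r subrr normr0 mulr_ge0 ?(ltW e0).
Qed.

Lemma derives_onD a b f g df dg : derives_on a b f df -> derives_on a b g dg ->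
  derives_on a b (fun t => f t + g t) (fun t => df t + dg t).
Proof.
move=> Hf Hg t tab e e0.
have e2 : 0 < e / 2 by rewrite divr_gt0.
have [r r0 Hr] := Hf t tab _ e2; have [s s0 Hs] := Hg t tab _ e2.
exists (Num.min r s); first by rewrite lt_min r0.
move=> u uab; rewrite lt_min => /andP[ur us].
have -> : f u + g u - (f t + g t) - (df t + dg t) * (u - t)
  = (f u - f t - df t * (u - t)) + (g u - g t - dg t * (u - t)) by ring.
rewrite (le_trans (ler_normD _ _))// [e]splitr mulrDl lerD ?Hr ?Hs//.
Qed.

Lemma derives_onM a b f g df dg : derives_on a b f df -> derives_on a b g dg ->
  derives_on a b (fun t => f t * g t) (fun t => df t * g t + f t * dg t).
Proof.
move=> Hf Hg t tab e e0.
pose c := `|g t| + `|dg t| + 1.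
pose k := `|df t| * (`|dg t| + 1) + 1.
have c0 : 0 < c by rewrite /c ltr_wpDl// addr_ge0.
have k0 : 0 < k by rewrite /k ltr_wpDl// mulr_ge0// addr_ge0.
have f0 : 0 < `|f t| + 1 by rewrite ltr_wpDl.
have e3 : 0 < e / 3 by rewrite divr_gt0.
pose e2 := Num.min 1 (e / 3 / (`|f t| + 1)).
have e20 : 0 < e2 by rewrite lt_min ltr01 divr_gt0.
have [r r0 Hr] := Hf t tab _ (divr_gt0 e3 c0).
have [s s0 Hs] := Hg t tab _ e20.
exists (Num.min (Num.min r s) (Num.min 1 (e / 3 / k))).
  by rewrite !lt_min r0 s0 ltr01 divr_gt0.
move=> u uab; rewrite !lt_min => /andP[/andP[/(Hr _ uab) Fu /(Hs _ uab) Gu] /andP[/ltW u1 /ltW uk]].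
pose x := u - t.
have -> : f u * g u - f t * g t - (df t * g t + f t * dg t) * (u - t)
  = (f u - f t - df t * x) * g u + f t * (g u - g t - dg t * x)
    + df t * x * (g u - g t) by rewrite /x; ring.
have gx : `|g u - g t| <= (`|dg t| + 1) * `|x|.
  rewrite -[g u - g t](subrK (dg t * x)) (le_trans (ler_normD _ _))// addrC mulrDl.
  rewrite lerD ?normrM// (le_trans Gu)// ler_wpM2r// ge_min lexx.
  by [].
have gu : `|g u| <= c.
  rewrite -(subrK (g t) (g u)) (le_trans (ler_normD _ _))// /c addrC -addrA lerD2l.
  by rewrite (le_trans gx)// ler_piMr// addr_ge0.
have -> : e * `|u - t| = e / 3 * `|x| + e / 3 * `|x| + e / 3 * `|x| by rewrite /x; field.
rewrite (le_trans (ler_normD _ _))// lerD//.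
  rewrite (le_trans (ler_normD _ _))// lerD// normrM.
    apply: (@le_trans _ _ (e / 3 / c * `|x| * c)); first by apply: ler_pM.
    by rewrite le_eqVlt; apply/orP; left; apply/eqP; field; rewrite gt_eqF.
  apply: (@le_trans _ _ ((`|f t| + 1) * (e2 * `|x|))).
    by apply: ler_pM => //; rewrite lerDl.
  rewrite mulrA ler_wpM2r// mulrC -ler_pdivlMr//.
  by rewrite ge_min lexx orbT.
rewrite normrM (normrM (df t)).
have xk : `|x| * k <= e / 3 by rewrite -ler_pdivlMr.
apply: (@le_trans _ _ (`|df t| * `|x| * ((`|dg t| + 1) * `|x|))).
  by rewrite ler_wpM2l ?mulr_ge0.
rewrite mulrA ler_wpM2r// (le_trans _ xk)// mulrAC mulrC ler_wpM2l//.
by rewrite /k lerDl.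
Qed.

Lemma derives_onZ a b c f df : derives_on a b f df ->
  derives_on a b (fun t => c * f t) (fun t => c * df t).
Proof.
move=> H; have := derives_onM (@derives_on_cst a b c) H.
by congr (derives_on a b _ _); apply: funext => t; rewrite mul0r add0r.
Qed.

Lemma derives_onB a b f g df dg : derives_on a b f df -> derives_on a b g dg ->
  derives_on a b (fun t => f t - g t) (fun t => df t - dg t).
Proof.
move=> Hf /(derives_onZ (-1)) Hg; have := derives_onD Hf Hg.
by congr (derives_on a b _ _); apply: funext => t; rewrite mulN1r.
Qed.

Lemma derives_on_sum (I : Type) (r : seq I) a b (f df : I -> R -> R) :
  (forall i, derives_on a b (f i) (df i)) ->
  derives_on a b (fun t => \sum_(i <- r) f i t) (fun t => \sum_(i <- r) df i t).
Proof.
move=> H; elim: r => [|i r IH].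
  have := @derives_on_cst a b 0.
  by congr (derives_on a b _ _); apply: funext => t; rewrite big_nil.
have := derives_onD (H i) IH.
by congr (derives_on a b _ _); apply: funext => t; rewrite big_cons.
Qed.

Lemma derives_on_is_derive a b f df :
  (forall t, is_derive t 1 f (df t)) -> derives_on a b f df.
Proof.
move=> H t _ e e0; have [df1 df2] := H t.
have /cvgrPdist_le/(_ e e0) lim_e : h^-1 *: (f (h *: 1 + t) - f t) @[h --> 0^'] --> df t.
  by rewrite -df2; exact: df1.
have /nbhs_ballP[d /= d0 Hd] : nbhs (0 : R) (fun h => h != 0 ->
    `|df t - h^-1 * (f (h * 1 + t) - f t)| <= e) := lim_e.
exists d => // u _ ut.
have [->|neq] := eqVneq u t; first by rewrite !subrr mulr0 subr0 normr0 mulr0.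
have ut0 : u - t != 0 by rewrite subr_eq0.
have := Hd (u - t); rewrite /ball /= distrC subr0 => /(_ ut ut0).
rewrite mulr1 subrK => Hu.
have -> : f u - f t - df t * (u - t)
    = - (df t - (u - t)^-1 * (f u - f t)) * (u - t) by field.
by rewrite normrM normrN ler_wpM2r.
Qed.

Lemma derives_on_interior a b f df t : derives_on a b f df -> a < t < b ->
  is_derive t 1 f (df t).
Proof.
move=> H /andP[at_ tb].
have tab : a <= t <= b by rewrite !ltW.
have lim : h^-1 *: (f (h *: 1 + t) - f t) @[h --> 0^'] --> df t.
  apply/cvgrPdist_le => e e0; have [d d0 Hd] := H t tab e e0.
  have : nbhs (0 : R) (fun h => h != 0 ->
      `|df t - h^-1 * (f (h * 1 + t) - f t)| <= e); last by [].
  apply/nbhs_ballP; exists (Num.min d (Num.min (t - a) (b - t))).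
    by rewrite /= !lt_min d0 !subr_gt0 at_.
  move=> h; rewrite /ball /= distrC subr0 !lt_min => /andP[hd /andP[hta htb]] h0.
  have hab : a <= h + t <= b.
    move: hta htb; rewrite !ltr_norml => /andP[? _] /andP[_ ?]; apply/andP; split; lra.
  have := Hd (h + t) hab; rewrite addrK mulr1 => /(_ hd) Hu.
  have E : f (h + t) - f t - df t * h
      = - (df t - h^-1 * (f (h + t) - f t)) * h by field.
  by move: Hu; rewrite E normrM normrN ler_pM2r ?normr_gt0.
by split; [exact: cvgP lim | exact: cvg_lim lim].
Qed.

Lemma derives_on_continuous a b f df :
  derives_on a b f df -> {within `[a, b], continuous f}.
Proof.
move=> H; apply/subspace_continuousP => t; rewrite /= in_itv /= => tab.
apply/cvgrPdist_le => e e0; have [d d0 Hd] := H t tab 1 ltr01.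
pose k := 1 + `|df t|; have k0 : 0 < k by rewrite ltr_pwDl.
have : nbhs t (fun u => u \in `[a, b] -> `|f t - f u| <= e); last by [].
apply/nbhs_ballP; exists (Num.min d (e / k)); first by rewrite /= lt_min d0 divr_gt0.
move=> u; rewrite /ball /= distrC lt_min in_itv => /andP[ud /ltW ue] uab.
rewrite distrC -[_ - _](subrK (df t * (u - t))) (le_trans (ler_normD _ _))//.
apply: (@le_trans _ _ (k * `|u - t|)).
  by rewrite mulrDl lerD ?Hd// normrM.
by rewrite mulrC -ler_pdivlMr.
Qed.

Lemma derives_on_MVT a b f df : a < b -> derives_on a b f df ->
  exists2 c, a < c < b & f b - f a = df c * (b - a).
Proof.
move=> ab H; have [x||c] := @MVT R f df a b ab; last by rewrite in_itv; exists c.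
  by rewrite in_itv => /(derives_on_interior H).
exact: derives_on_continuous H.
Qed.

(** A mean value inequality: monotonicity of g - f and g + f. *)
Lemma derives_on_le a b f df g dg : a <= b ->
  derives_on a b f df -> derives_on a b g dg ->
  (forall t, a <= t <= b -> `|df t| <= dg t) -> `|f b - f a| <= g b - g a.
Proof.
rewrite le_eqVlt => /predU1P[->|ab] Hf Hg fg; first by rewrite !subrr normr0.
have Hm := derives_on_MVT ab (derives_onB Hg Hf).
have Hp := derives_on_MVT ab (derives_onD Hg Hf).
have bound c : a < c < b -> - dg c <= df c <= dg c.
  by move=> /andP[? ?]; rewrite -ler_norml fg// !ltW.
have [c /bound /andP[c1 c2] Ec] := Hm.
have [x /bound /andP[x1 x2] Ex] := Hp.
have m0 : 0 <= (dg c - df c) * (b - a) by rewrite mulr_ge0// subr_ge0// ltW.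
have p0 : 0 <= (dg x + df x) * (b - a).
  by apply: mulr_ge0; [lra | rewrite subr_ge0 ltW].
rewrite ler_norml; apply/andP; split; lra.
Qed.

End Calculus.

(** * Taylor expansion and quadrature *)

Section Taylor.
Variable R : realType.

Lemma derives_on_monomial (a b : R) k :
  derives_on a b (fun t => t ^+ k.+1 / k.+1`!%:R) (fun t => t ^+ k / k`!%:R).
Proof.
have pow : derives_on a b (fun t => t ^+ k.+1) (fun t => k.+1%:R * t ^+ k).
  elim: k => [|k IH].
    have := @derives_on_id R a b.
    by congr (derives_on a b _ _); apply: funext => t; rewrite ?expr1// expr0 mulr1.
  have := derives_onM (@derives_on_id R a b) IH.
  congr (derives_on a b _ _); apply: funext => t.
  rewrite mul1r mulrCA -exprS -[k.+2]addn1 natrD mulrDl mul1r addrC.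
  by [].
have := derives_onZ (k.+1`!%:R)^-1 pow.
congr (derives_on a b _ _); apply: funext => t; first by rewrite mulrC.
rewrite factS natrM invfM; have k0 : k.+1%:R != 0 :> R by rewrite pnatr_eq0.
have f0 : k`!%:R != 0 :> R by rewrite pnatr_eq0 -lt0n fact_gt0.
by field; rewrite nat1r f0.
Qed.

(** The functions D 0, D 1, ... are successive derivatives on the interval.
    Induction on p: the remainder of D 0 has the remainder of D 1 as derivative,
    and is compared with the monomial bounding the latter. *)
Lemma taylor_remainder (p : nat) (D : nat -> R -> R) (h M t : R) :
  (forall k, (k < p)%N -> derives_on 0 h (D k) (D k.+1)) ->
  (forall s, 0 <= s <= h -> `|D p s| <= M) -> 0 <= t <= h ->
  `|D 0%N t - \sum_(k < p) D k 0 * (t ^+ k / k`!%:R)| <= M * (t ^+ p / p`!%:R).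
Proof.
elim: p D t => [|p IH] D t HD HM th.
  by rewrite big_ord0 subr0 expr0 fact0 divr1 mulr1 HM.
have /andP[t0 ht] := th.
pose f s := D 0%N s - \sum_(k < p) D k.+1 0 * (s ^+ k.+1 / k.+1`!%:R).
pose df s := D 1%N s - \sum_(k < p) D k.+1 0 * (s ^+ k / k`!%:R).
have Hf : derives_on 0 t f df.
  apply: derives_onB; first exact: derives_on_sub (lexx 0) ht (HD 0%N _).
  by apply: derives_on_sum => k; apply/derives_onZ/derives_on_monomial.
have Hg := derives_onZ M (@derives_on_monomial 0 t p).
have := derives_on_le t0 Hf Hg.
rewrite /f expr0n mul0r mulr0 subr0 big_ord_recl expr0 fact0 divr1 mulr1.
rewrite [X in _ - (D 0%N 0 - X)]big1 => [|k _]; last by rewrite expr0n/= mul0r mulr0.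
rewrite subr0 opprD addrA [_ - D 0%N 0]addrAC; apply => s /andP[s0 st].
apply: (IH (fun k => D k.+1)) => //; first by move=> k kp; apply: HD.
by rewrite s0 (le_trans st).
Qed.

Lemma ler_div_fact (x : R) k : 0 <= x -> x / k`!%:R <= x.
Proof.
by move=> x0; rewrite ler_pdivrMr ?ltr0n ?fact_gt0// ler_peMr// ler1n fact_gt0.
Qed.

(** A bound on the top derivative propagates down to the function itself, the
    interval being bounded. *)
Lemma chain_bounded (p : nat) (D : nat -> R -> R) (h M : R) :
  (forall k, (k < p)%N -> derives_on 0 h (D k) (D k.+1)) ->
  (forall s, 0 <= s <= h -> `|D p s| <= M) ->
  exists M', forall s, 0 <= s <= h -> `|D 0%N s| <= M'.
Proof.
move=> HD HM.
exists (M * h ^+ p + \sum_(k < p) `|D k 0| * h ^+ k) => s sh.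
have /andP[s0 sh'] := sh; have h0 := le_trans s0 sh'.
have M0 : 0 <= M by apply: le_trans (HM s sh).
rewrite -[D 0%N s](subrK (\sum_(k < p) D k 0 * (s ^+ k / k`!%:R))).
have bd k : s ^+ k / k`!%:R <= h ^+ k.
  by rewrite (le_trans (ler_div_fact _ _)) ?exprn_ge0// lerXn2r.
rewrite (le_trans (ler_normD _ _))// lerD//.
  by rewrite (le_trans (taylor_remainder HD HM sh))// ler_wpM2l.
rewrite (le_trans (ler_norm_sum _ _ _))//; apply: ler_sum => k _.
by rewrite normrM ler_wpM2l// ger0_norm ?divr_ge0 ?exprn_ge0// bd.
Qed.

Lemma euler_remainder (D : nat -> R -> R) (h M s eta : R) :
  derives_on 0 h (D 0%N) (D 1%N) -> derives_on 0 h (D 1%N) (D 2%N) ->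
  (forall u, 0 <= u <= h -> `|D 2%N u| <= M) ->
  0 <= s -> 0 <= eta -> s + eta <= h ->
  `|D 0%N (s + eta) - D 0%N s - eta * D 1%N s| <= M * eta ^+ 2.
Proof.
move=> H0 H1 HM s0 eta0 sh.
have shift f df : derives_on 0 h f df ->
    derives_on 0 eta (fun t => f (s + t)) (fun t => df (s + t)).
  move=> /(@derives_on_shift R 0 h s f df); apply: derives_on_sub; first by rewrite sub0r oppr_le0.
  by rewrite lerBrDl.
have := @taylor_remainder 2 (fun k t => D k (s + t)) eta M eta.
have b01 : bump 0 0 = 1%N by []; have f1 : 1`! = 1%N by [].
rewrite !big_ord_recl big_ord0 /= !addr0 b01 f1 fact0 expr0 expr1 !divr1 mulr1.
have -> x y z : x - (y + z) = x - y - z :> R by rewrite opprD addrA.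
rewrite (mulrC _ eta); move=> H; apply: le_trans (H _ _ _) _.
- by case=> [_|[_|//]]; apply: shift.
- move=> u /andP[u0 ueta]; apply: HM; rewrite addr_ge0//=.
  by rewrite (le_trans _ sh)// lerD2l.
- by rewrite eta0 lexx.
- rewrite ler_wpM2l// ?ler_div_fact ?sqr_ge0//.
  have h00 : 0 <= (0 : R) <= h by rewrite lexx/= (le_trans _ sh) ?addr_ge0.
  exact: le_trans (normr_ge0 _) (HM 0 h00).
Qed.

(** D 1 is the integrand and D 0 a primitive.  The moment conditions make the
    quadrature rule exact on the Taylor polynomial of D 1, so only the two Taylor
    remainders are left. *)
Lemma quadrature_error (p s : nat) (b c : 'I_s -> R) (D : nat -> R -> R) (h M : R) :
  0 <= h -> (forall i, 0 <= c i <= 1) ->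
  (forall k, (k < p)%N -> \sum_i b i * c i ^+ k = k.+1%:R^-1) ->
  (forall k, (k < p.+1)%N -> derives_on 0 h (D k) (D k.+1)) ->
  (forall t, 0 <= t <= h -> `|D p.+1 t| <= M) ->
  `|h * (\sum_i b i * D 1%N (c i * h)) - (D 0%N h - D 0%N 0)|
    <= M * (1 + \sum_i `|b i|) * h ^+ p.+1.
Proof.
move=> h0 c01 moments HD HM.
have hh : 0 <= h <= h by rewrite h0 lexx.
have M0 : 0 <= M by apply: le_trans (HM h hh).
have ch i : 0 <= c i * h <= h.
  by have /andP[? ?] := c01 i; rewrite mulr_ge0// ler_piMl.
pose q i := \sum_(k < p) D k.+1 0 * ((c i * h) ^+ k / k`!%:R).
have T0 := taylor_remainder HD HM hh.
have T1 i : `|D 1%N (c i * h) - q i| <= M * ((c i * h) ^+ p / p`!%:R).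
  by apply: (@taylor_remainder _ (fun k => D k.+1) h) => // k kp; apply: HD.
move: T0; rewrite big_ord_recl expr0 fact0 divr1 mulr1 opprD addrA.
have -> : \sum_(k < p) D (lift ord0 k) 0 * (h ^+ (lift ord0 k) / (lift ord0 k)`!%:R)
    = h * \sum_i b i * q i.
  transitivity (\sum_(k < p) (\sum_i b i * c i ^+ k) * (D k.+1 0 * (h ^+ k.+1 / k`!%:R))).
    apply: eq_bigr => k _; rewrite moments// lift0 factS natrM exprS.
    have f0 : k`!%:R != 0 :> R by rewrite pnatr_eq0 -lt0n fact_gt0.
    by field; rewrite f0 nat1r pnatr_eq0.
  rewrite mulr_sumr; under eq_bigr do rewrite mulr_suml.
  rewrite exchange_big; apply: eq_bigr => i _; rewrite /q !mulr_sumr.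
  by apply: eq_bigr => k _; rewrite exprMn exprS; ring.
move=> T0.
have -> : h * (\sum_i b i * D 1%N (c i * h)) - (D 0%N h - D 0%N 0)
    = h * (\sum_i b i * (D 1%N (c i * h) - q i))
      - (D 0%N h - D 0%N 0 - h * \sum_i b i * q i).
  under [in RHS]eq_bigr do rewrite mulrBr.
  by rewrite sumrB; ring.
rewrite (le_trans (ler_normB _ _))// mulrDr mulr1 mulrDl addrC lerD//.
  by rewrite (le_trans T0)// ler_wpM2l// ler_div_fact// exprn_ge0.
rewrite normrM ger0_norm// exprS mulrCA ler_wpM2l//.
rewrite -mulrA mulr_suml mulr_sumr (le_trans (ler_norm_sum _ _ _))//.
apply: ler_sum => i _; rewrite normrM mulrCA ler_wpM2l//.
have /andP[ci0 cih] := ch i.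
rewrite (le_trans (T1 i))// ler_wpM2l//.
by rewrite (le_trans (ler_div_fact _ _)) ?exprn_ge0// lerXn2r.
Qed.

End Taylor.

(** * Growth of the difference of two solutions *)

Section Stability.
Variables (R : realType) (m n : nat).

(** The function |D|^2 exp(- 2 L t) is nonincreasing.  Squaring avoids
    differentiating the norm where D vanishes. *)
Lemma gronwall_frob (D dD : R -> 'M[R]_(m, n)) (L h : R) : 0 <= h ->
  (forall i j, derives_on 0 h (fun t => D t i j) (fun t => dD t i j)) ->
  (forall t, 0 <= t <= h -> frob (dD t) <= L * frob (D t)) ->
  frob (D h) <= expR (L * h) * frob (D 0).
Proof.
rewrite le_eqVlt => /predU1P[<-|h0] HD HL; first by rewrite mulr0 expR0 mul1r.
pose E t := expR (- (2 * L) * t).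
have HE : derives_on 0 h E (fun t => E t * - (2 * L)).
  apply: derives_on_is_derive => t; apply: (@is_derive1_comp _ expR).
  have := @is_deriveZ R R R id (- (2 * L)) t 1 1 (is_derive_id _ _).
  by rewrite /GRing.scale /= mulr1.
have HV : derives_on 0 h (fun t => mxdot (D t) (D t)) (fun t => 2 * mxdot (D t) (dD t)).
  have : derives_on 0 h (fun t => mxdot (D t) (D t))
      (fun t => \sum_i \sum_j (dD t i j * D t i j + D t i j * dD t i j)).
    apply: derives_on_sum => i; apply: derives_on_sum => j.
    exact: derives_onM.
  congr (derives_on 0 h _ _); apply: funext => t; rewrite mulr_sumr.
  apply: eq_bigr => i _; rewrite mulr_sumr; apply: eq_bigr => j _.
  by ring.
have [c /andP[c0 ch] Ec] := derives_on_MVT h0 (derives_onM HV HE).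
have le0 : mxdot (D h) (D h) * E h - mxdot (D 0) (D 0) * E 0 <= 0.
  rewrite Ec subr0 mulr_le0_ge0 ?(ltW h0)//.
  have := le_trans (ler_norm _) (mxdot_le (D c) (dD c)).
  have HLc : frob (dD c) <= L * frob (D c) by apply: HL; rewrite !ltW.
  have := ler_wpM2l (frob_ge0 (D c)) HLc.
  have := expR_gt0 (- (2 * L) * c); rewrite -/(E c) -frob_sqr.
  move: (E c) (frob (D c)) (frob (dD c)) (mxdot _ _) => x y z u x0 H1 H2.
  have : u - L * y ^+ 2 <= 0 by move: H1 H2; rewrite expr2; lra.
  by move: x0; move: (u - _) (erefl (u - L * y ^+ 2)) => v Ev x0 v0; nra.
apply: frob_le; first by rewrite mulr_ge0 ?frob_ge0 ?expR_ge0.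
move: le0; rewrite subr_le0 {2}/E mulr0 expR0 mulr1.
rewrite exprMn frob_sqr -ler_pdivlMr ?expR_gt0// => /le_trans; apply.
rewrite mulrC ler_wpM2r ?mxdot_ge0// /E -expRN -expRM_natl.
by rewrite mulNr opprK mulrA.
Qed.

End Stability.

(** * The reduced K-L step *)

Section KLStep.
Variables (R : realType) (m n r : nat).
Implicit Types (X : factors R m n r) (dA : 'M[R]_(m, n)).

Lemma kl_KE X dA : orthonormal_cols (facV X) ->
  kl_K X dA = (fmat X + dA) *m facV X.
Proof. by move=> VV; rewrite mulmxDl /fmat -[_ *m _^T *m _]mulmxA VV mulmx1. Qed.

Lemma kl_LE X dA (U1 : 'M[R]_(m, r)) : kl_L X dA U1 = (fmat X + dA)^T *m U1.
Proof. by rewrite linearD /= mulmxDl /kl_L /fmat !trmx_mul trmxK !mulmxA. Qed.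

Lemma kl_step_output X dA X1 : kl_step X dA X1 ->
  fmat X1 = facU X1 *m (facU X1)^T *m (fmat X + dA).
Proof.
move=> [_ _ _ VS]; rewrite /fmat -mulmxA -[facS X1 *m _]trmxK trmx_mul trmxK VS.
by rewrite kl_LE trmx_mul trmxK mulmxA.
Qed.

(** K_1 = U_1 S has rank r, so S is invertible, and S = S_1 (V_1^T V_0) forces
    S_1 to be invertible. *)
Lemma kl_step_rank_r X dA X1 : rank_r_factors X -> kl_step X dA X1 ->
  kl_admissible X dA -> rank_r_factors X1.
Proof.
move=> [_ VV _] [UU [S US] V1V1 VS] rK; split=> //.
have SE : facS X1 *m ((facV X1)^T *m facV X) = S.
  rewrite mulmxA -[facS X1 *m _]trmxK trmx_mul trmxK VS kl_LE trmx_mul trmxK.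
  by rewrite -mulmxA -kl_KE// -US mulmxA UU mul1mx.
have uS : S \in unitmx.
  rewrite -row_full_unit -col_leq_rank; rewrite /kl_admissible -US in rK.
  by rewrite -{1}rK mxrankM_maxr.
by move: uS; rewrite -SE unitmx_mul => /andP[].
Qed.

End KLStep.

(** * One step *)

Section FlowRowSpace.
Variables (R : realType) (m n r : nat).

(** The grid is chosen so fine that the consistency errors of the Euler scheme
    are below d. *)
Lemma row_space_along_flow (V0 : 'M[R]_(n, r)) (G : R -> 'M[R]_(m, n) -> 'M[R]_(m, n))
    (A : R -> 'M[R]_(m, n)) (L B eps h M d : R) :
  let w : R := Num.sqrt r%:R + 1 in
  let q : R := Num.sqrt n%:R + Num.sqrt r%:R * w in
  orthonormal_cols V0 -> (0 < n)%N -> 0 <= L -> 0 <= eps -> 0 < d -> 0 < h ->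
  h * (n%:R * q * (L * w)) <= 2^-1 -> h * (L * q) <= 2^-1 ->
  A 0 *m V0 *m V0^T = A 0 ->
  (forall s eta i j, 0 <= s -> 0 <= eta -> s + eta <= h ->
    `|A (s + eta) i j - A s i j - eta * G s (A s) i j| <= M * eta ^+ 2) ->
  (forall s Y, 0 <= s <= h -> frob (G s Y) <= B) ->
  (forall s Y Z, 0 <= s <= h -> frob (G s Y - G s Z) <= L * frob (Y - Z)) ->
  (forall s, 0 <= s <= h -> near_tangent r eps L (G s)) ->
  exists2 W : 'M[R]_(n, r), frob (W - V0) <= 1
    & frob (A h *m (1%:M - V0 *m W^T)) <= 2 * (2 * n%:R * q + q + 1) * (h * (eps + d)).
Proof.
move=> w q V0o n0 L0 eps0 d0 h0 hLw hLq A0 Aeuler GB GL GT.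
pose x := ((m * n)%:R * `|M| * h + `|B| * Num.sqrt r%:R) / d.
have x0 : 0 <= x.
  by rewrite divr_ge0 ?(ltW d0)// addr_ge0 ?mulr_ge0 ?sqrtr_ge0 ?(ltW h0).
pose N := (Num.bound x).+1; pose eta := h / N%:R.
have N0 : 0 < N%:R :> R by rewrite ltr0n.
have xN : x <= N%:R.
  by rewrite (le_trans (ltW (archi_boundP x0)))// ler_nat.
have eta0 : 0 < eta by rewrite divr_gt0.
have etaN : N%:R * eta = h by rewrite mulrC divfK// gt_eqF.
have [xN1 xN2] : (m * n)%:R * `|M| * eta <= d /\ `|B| * Num.sqrt r%:R <= N%:R * d.
  move: xN; rewrite /x ler_pdivrMr// => xN.
  have B0 : 0 <= `|B| * Num.sqrt r%:R by rewrite mulr_ge0 ?sqrtr_ge0.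
  have M0 : 0 <= (m * n)%:R * `|M| * h by rewrite !mulr_ge0 ?(ltW h0).
  split; last by apply: le_trans xN; rewrite lerDr.
  rewrite /eta mulrA ler_pdivrMr// (mulrC d); apply: le_trans xN.
  by rewrite lerDl.
have grid k : k.+1%:R * eta <= h ->
    [/\ 0 <= k%:R * eta <= h, k%:R * eta + eta <= h & k.+1%:R * eta = k%:R * eta + eta].
  rewrite -[k.+1]addn1 natrD mulrDl mul1r => H; split=> //.
  by rewrite mulr_ge0 ?(ltW eta0)// (le_trans _ H)// lerDl ltW.
have etaB : eta * (B * Num.sqrt r%:R) <= d * h.
  rewrite -etaN [leRHS]mulrA mulrC ler_wpM2r ?(ltW eta0)//.
  rewrite (mulrC d); apply: le_trans xN2.
  by rewrite ler_wpM2r ?sqrtr_ge0 ?ler_norm.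
have Nh : N%:R * eta <= h by rewrite etaN.
have E0 : A (0%:R * eta) *m V0 *m V0^T = A (0%:R * eta) by rewrite mul0r.
have [k hk|k Y hk|k Y Z hk|k hk|W [_ WV EW]] := @euler_row_space R m n r V0 V0o
  L B eps d h eta n0 L0 eps0 d0 h0 eta0 hLw hLq etaB (fun k => A (k%:R * eta))
  (fun k => G (k%:R * eta)) E0 _ _ _ _ N Nh.
- have [/andP[s0 sh] sh' ->] := grid k hk.
  apply: (@le_trans _ _ ((m * n)%:R * (`|M| * eta ^+ 2))).
    apply: frob_le_entries => [|i j]; first by rewrite mulr_ge0 ?sqr_ge0.
    rewrite !mxE (le_trans (Aeuler _ _ i j s0 (ltW eta0) sh'))//.
    by rewrite ler_wpM2r ?sqr_ge0 ?ler_norm.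
  have -> : (m * n)%:R * (`|M| * eta ^+ 2) = eta * ((m * n)%:R * `|M| * eta) by ring.
  by rewrite ler_pM2l.
- by have [? _ _] := grid k hk; apply: GB.
- by have [? _ _] := grid k hk; apply: GL.
- by have [? _ _] := grid k hk; apply: GT.
exists W.
  by move: WV; rewrite etaN mulfV ?gt_eqF.
move: EW; rewrite etaN -/w -/q => /le_trans; apply.
have q0 : 0 <= q.
  by rewrite /q addr_ge0 ?mulr_ge0 ?sqrtr_ge0// /w addr_ge0 ?sqrtr_ge0.
have -> : 2 * (2 * n%:R * q + q + 1) * (h * (eps + d))
  = 2 * h * ((2 * n%:R * q + q + 1) * (eps + d)) by ring.
apply: ler_wpM2l; first by rewrite mulr_ge0 ?(ltW h0).
have : 0 <= (q + 1) * eps by rewrite mulr_ge0// addr_ge0.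
by move: (n%:R : R) => y; lra.
Qed.

End FlowRowSpace.

Section OneStep.
Variables (R : realType) (m n r : nat).
Implicit Types (F : R -> 'M[R]_(m, n) -> 'M[R]_(m, n)) (An : R -> 'M[R]_(m, n)).

(** A single indexing for the solution and the derivatives of its velocity, so
    that the Taylor bounds apply from either level: index 1 is g_n itself. *)
Definition flow_chain F (tn h : R) An i j k t : R :=
  if k is k'.+1 then
    derive_within_n [set` `[0, h]] k' (fun s => F (tn + s) (An s)) t i j
  else An t i j.

Variables (s p : nat) (tab : tableau R s) (T B LF eps Mp Cst tn h : R).
Variables (F : R -> 'M[R]_(m, n) -> 'M[R]_(m, n)) (An : R -> 'M[R]_(m, n)).
Variables (Xn Xn1 : factors R m n r) (Ys Fs : 'I_s -> 'M[R]_(m, n)).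
Hypotheses (p0 : (0 < p)%N) (r0 : (0 < r)%N) (rm : (r < m)%N) (rn : (r < n)%N).
Hypotheses (etab : explicit_tableau tab) (qtab : quadrature_conditions tab p).
Hypothesis saF : standing_assumptions r T B LF eps F.
Hypotheses (h0 : 0 < h) (tn0 : 0 <= tn) (tnT : tn <= T - h).
Hypothesis saX : step_assumptions tab F p Mp Cst eps tn h (fmat Xn) Ys An.
Hypothesis step : rk_step tab F tn h Xn Ys Fs Xn1.

Let flow_time t : 0 <= t <= h -> tn + t \in `[0, T].
Proof.
move=> /andP[t0 th]; rewrite in_itv /= addr_ge0//=.
by rewrite -lerBrDr (le_trans tnT)// lerD2l lerN2.
Qed.

Let F_lip t Y Z : 0 <= t <= h ->
  frob (F (tn + t) Y - F (tn + t) Z) <= `|LF| * frob (Y - Z).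
Proof.
move=> /flow_time tT; rewrite (le_trans (sa_lipschitz saF _ _ tT))//.
by rewrite ler_wpM2r ?frob_ge0 ?ler_norm.
Qed.

Lemma flow_chain_derives i j k : (k <= p)%N ->
  derives_on 0 h (flow_chain F tn h An i j k) (flow_chain F tn h An i j k.+1).
Proof.
have [[_ ivp] [Cp _] _ _] := saX.
case: k => [_|k kp]; first exact: derives_on_entry.
by apply: derives_on_entry => t th; apply: Cp.
Qed.

Lemma flow_chain_bounded i j t : 0 <= t <= h ->
  `|flow_chain F tn h An i j p.+1 t| <= Mp.
Proof.
have [_ _ HM _] := saX => th; apply: le_trans (frob_entry _ i j) _.
by apply: HM; rewrite in_itv.
Qed.

(** The bound M may depend on the solution: it only governs how fine the Euler
    grid must be, not the final constants. *)
Lemma flow_euler_remainder : exists M, forall t eta i j,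
  0 <= t -> 0 <= eta -> t + eta <= h ->
  `|An (t + eta) i j - An t i j - eta * F (tn + t) (An t) i j| <= M * eta ^+ 2.
Proof.
have bnd (ij : 'I_m * 'I_n) : exists M, forall t, 0 <= t <= h ->
    `|flow_chain F tn h An ij.1 ij.2 2 t| <= M.
  apply: (@chain_bounded _ p.-1 (fun k => flow_chain F tn h An ij.1 ij.2 k.+2) h Mp).
    by move=> k kp; apply: flow_chain_derives; rewrite -(prednK p0).
  by move=> t th; rewrite prednK//; exact: flow_chain_bounded.
have [M HM] := choice bnd.
exists (\sum_ij `|M ij|) => t eta i j t0 eta0 th.
apply: (@euler_remainder _ (flow_chain F tn h An i j) h _ _ _ _ _ _ t0 eta0 th).
- exact: flow_chain_derives.
- exact: flow_chain_derives.
move=> u uh; rewrite (le_trans (HM (i, j) u uh))// (le_trans (ler_norm _))//.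
by rewrite (bigD1 (i, j))//= lerDl sumr_ge0.
Qed.

Lemma rk_stage_value i : Fs i = F (tn + tab_c tab i * h) (Ys i).
Proof.
have [S0 Si _] := step; have [_ cE _] := etab.
have [i0|i0] := posnP i; last by have [_ ->] := Si i i0.
have [-> ->] := S0 i i0; rewrite cE big_pred0 ?mul0r ?addr0// => j.
by rewrite i0 ltn0.
Qed.

Let beta : R := \sum_i `|tab_b tab i|.

Definition increment_const : R :=
  (m * n)%:R * (`|Mp| * (1 + beta)) + `|LF| * `|Cst| * beta.

(** The stage errors enter through h F, which yields the extra factor h on
    eps; the rest is the error of the quadrature rule applied to g_n. *)
Lemma increment_error :
  frob (fmat Xn + final_increment tab h Fs - An h)
    <= increment_const * (h ^+ p.+1 + h ^+ 2 * eps).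
Proof.
have [[An0 _] _ _ Yst] := saX; have [_ _ c01] := etab; have [b1 bc] := qtab.
have eps0 := sa_eps_ge0 saF.
have ch i : 0 <= tab_c tab i * h <= h.
  by have /andP[? ?] := c01 i; rewrite mulr_ge0 ?(ltW h0)//= ler_piMl ?(ltW h0).
pose g t := F (tn + t) (An t).
pose S1 := h *: \sum_i tab_b tab i *: (Fs i - g (tab_c tab i * h)).
pose S2 := h *: (\sum_i tab_b tab i *: g (tab_c tab i * h)) - (An h - An 0).
have -> : fmat Xn + final_increment tab h Fs - An h = S1 + S2.
  rewrite /S1 /S2 -An0 /final_increment.
  under [in RHS]eq_bigr do rewrite scalerBr.
  rewrite sumrB scalerBr addrA subrK opprB addrA addrAC [in LHS](addrC (An 0)).
  by rewrite addrAC.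
have hp0 : 0 <= h ^+ p.+1 by rewrite exprn_ge0 ?(ltW h0).
have he0 : 0 <= h ^+ 2 * eps by rewrite mulr_ge0 ?exprn_ge0 ?(ltW h0).
have beta0 : 0 <= beta by rewrite sumr_ge0.
rewrite (le_trans (frobD _ _))// /increment_const mulrDl addrC lerD//.
  apply: (@le_trans _ _ ((m * n)%:R * (`|Mp| * (1 + beta) * h ^+ p.+1))).
    apply: frob_le_entries => [|i j].
      by rewrite !mulr_ge0// addr_ge0.
    have moments k : (k < p)%N -> \sum_i tab_b tab i * tab_c tab i ^+ k = k.+1%:R^-1.
      case: k => [_|k kp]; last by apply: bc; rewrite /= -ltnS prednK.
      by rewrite invr1 -b1; apply: eq_bigr => i' _; rewrite expr0 mulr1.
    have := @quadrature_error R p s _ _ (flow_chain F tn h An i j) h Mp (ltW h0)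
      c01 moments (fun k kp => @flow_chain_derives i j k kp) (@flow_chain_bounded i j).
    move=> Q; apply: le_trans (le_trans _ Q) _; last first.
      by rewrite ler_wpM2r// ler_wpM2r ?ler_norm// addr_ge0.
    rewrite le_eqVlt; apply/orP; left; apply/eqP; congr (`|_|).
    rewrite /S2 !mxE summxE; congr (_ * _ - _).
    by apply: eq_bigr => i' _; rewrite mxE.
  by rewrite mulrA ler_wpM2l ?mulr_ge0 ?addr_ge0// lerDl.
rewrite /S1 frobZ gtr0_norm//.
apply: (@le_trans _ _ (h * (beta * (`|LF| * (`|Cst| * (h ^+ p + h * eps)))))).
  rewrite ler_wpM2l ?(ltW h0)// (le_trans (frob_sum _ _ _))// /beta mulr_suml.
  apply: ler_sum => i _; rewrite frobZ.
  have [->|bi] := eqVneq (tab_b tab i) 0; first by rewrite normr0 !mul0r.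
  rewrite ler_wpM2l// rk_stage_value (le_trans (F_lip _ _ (ch i)))// ler_wpM2l//.
  rewrite (le_trans (Yst i bi))// ler_wpM2r ?ler_norm//.
  by rewrite addr_ge0 ?mulr_ge0 ?exprn_ge0 ?(ltW h0).
by rewrite le_eqVlt; apply/orP; left; apply/eqP; rewrite exprS expr2; ring.
Qed.

Let w : R := Num.sqrt r%:R + 1.
Let q : R := Num.sqrt n%:R + Num.sqrt r%:R * w.

(** Its inverse limits the stepsize: over one step the row space of the flow turns
    by a bounded amount as long as h times this constant is at most 1/2. *)
Definition row_space_const : R := n%:R * q * (`|LF| * w) + `|LF| * q.

(** An upper bound for the Frobenius norm of I - U_1 U_1^T. *)
Definition projection_const : R := Num.sqrt m%:R + r%:R.

Definition step_const : R :=
  projection_const * (2 * (2 * n%:R * q + q + 1))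
  + (projection_const * q + 2) * increment_const.

Hypotheses (rX : rank_r_factors Xn) (h1 : h <= 1).
Hypothesis hrow : h * row_space_const <= 2^-1.

(** The row-space bound holds with eps + d for every d > 0, and its right-hand
    side does not mention W, so d can tend to 0. *)
Lemma rk_step_error :
  frob (fmat Xn1 - An h) <= step_const * (h ^+ p.+1 + h * eps).
Proof.
have [U0o V0o _] := rX; have [_ _ kl] := step; have eps0 := sa_eps_ge0 saF.
have [U1o [S1 US] _ _] := kl; rewrite kl_KE// in US.
have d_le := increment_error.
set Z := fmat Xn + final_increment tab h Fs in US d_le.
have w0 : 0 <= w by rewrite /w addr_ge0 ?sqrtr_ge0.
have q0 : 0 <= q by rewrite /q addr_ge0 ?mulr_ge0 ?sqrtr_ge0.
have L0 : 0 <= `|LF| by [].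
have pi0 : 0 <= projection_const by rewrite addr_ge0 ?sqrtr_ge0.
have inc0 : 0 <= increment_const.
  by rewrite addr_ge0 ?mulr_ge0 ?addr_ge0// sumr_ge0.
have hw : h * (n%:R * q * (`|LF| * w)) <= 2^-1.
  by apply: le_trans hrow; rewrite ler_wpM2l ?(ltW h0)// lerDl mulr_ge0.
have hq : h * (`|LF| * q) <= 2^-1.
  by apply: le_trans hrow; rewrite ler_wpM2l ?(ltW h0)// lerDr !mulr_ge0.
have [[An0 _] _ _ _] := saX.
have A0 : An 0 *m facV Xn *m (facV Xn)^T = An 0.
  by rewrite An0 /fmat -[_ *m _^T *m facV Xn]mulmxA V0o mulmx1.
have [M HM] := flow_euler_remainder.
have GT t : 0 <= t <= h -> near_tangent r eps `|LF| (F (tn + t)).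
  move=> th; have tT := flow_time th; apply: near_tangentP => //.
    by move=> Y Z'; apply: F_lip.
  by move=> X rkX; apply: (sa_normal_defect saF tT rkX).
have proj : frob (Z - facU Xn1 *m (facU Xn1)^T *m Z)
    <= projection_const * (2 * (2 * n%:R * q + q + 1) * (h * eps) + q * frob (Z - An h)).
  pose c := projection_const * (2 * (2 * n%:R * q + q + 1)) * h.
  have c0 : 0 <= c by rewrite !mulr_ge0 ?addr_ge0 ?mulr_ge0 ?(ltW h0).
  apply/ler_addgt0Pr => e e0.
  have d0 : 0 < e / (c + 1) by rewrite divr_gt0// ltr_wpDl.
  have [W WV EW] := row_space_along_flow V0o (ltn_trans r0 rn) L0 eps0 d0 h0 hw hq A0
    HM (fun t Y th => sa_bounded saF Y (flow_time th)) F_lip GT.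
  apply: le_trans (range_projection_error (An h) V0o U1o US WV) _.
  rewrite -/projection_const -/w -/q.
  apply: (@le_trans _ _ (projection_const *
      (2 * (2 * n%:R * q + q + 1) * (h * (eps + e / (c + 1))) + q * frob (Z - An h)))).
    by rewrite ler_wpM2l// lerD2r.
  have : c * (e / (c + 1)) <= e.
    by rewrite mulrA ler_pdivrMr ?ltr_wpDl// mulrC ler_wpM2l ?(ltW e0)// lerDl.
  by rewrite /c; move: (e / _) => x; lra.
have heps0 : 0 <= h * eps by rewrite mulr_ge0// ltW.
have hp0 : 0 <= h ^+ p.+1 by rewrite exprn_ge0// ltW.
have dh : frob (Z - An h) <= increment_const * (h ^+ p.+1 + h * eps).
  apply: le_trans d_le _; rewrite ler_wpM2l// lerD2l expr2 -mulrA.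
  by rewrite ler_piMl.
rewrite (kl_step_output kl) -/Z.
have -> : facU Xn1 *m (facU Xn1)^T *m Z - An h
    = (Z - An h) - (Z - facU Xn1 *m (facU Xn1)^T *m Z).
  by rewrite opprB [RHS]addrC addrA subrK.
rewrite (le_trans (frobB _ _))// /step_const.
have e1 : h * eps <= h ^+ p.+1 + h * eps by rewrite lerDr.
have k0 : 0 <= projection_const * (2 * (2 * n%:R * q + q + 1)).
  by rewrite !mulr_ge0 ?addr_ge0 ?mulr_ge0.
have x1 := ler_wpM2l k0 e1.
have x2 := ler_wpM2l (mulr_ge0 pi0 q0) dh.
have x3 : 0 <= increment_const * (h ^+ p.+1 + h * eps).
  by rewrite mulr_ge0// addr_ge0.
move: proj dh x1 x2 x3.
move: (frob _) (frob _) (h * eps) (h ^+ p.+1) increment_const => a b x y z.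
lra.
Qed.

Lemma rk_step_rank_r : rk_admissible tab h Xn Fs -> rank_r_factors Xn1.
Proof.
by move=> [_ adm]; have [_ _ kl] := step; exact: kl_step_rank_r kl adm.
Qed.

End OneStep.

(** * Error propagation *)

Section Propagation.
Variables (R : realType) (m n r : nat).

Lemma flow_stability (F : R -> 'M[R]_(m, n) -> 'M[R]_(m, n)) (T LF t0 tn h : R)
    (Y0 A0 : 'M[R]_(m, n)) (An A : R -> 'M[R]_(m, n)) :
  (forall t Y Z, t \in `[0, T] -> frob (F t Y - F t Z) <= LF * frob (Y - Z)) ->
  0 <= t0 -> t0 <= tn -> 0 <= h -> tn + h <= T ->
  solves_ivp (fun t => F (tn + t)) 0 h Y0 An ->
  solves_ivp F t0 T A0 A ->
  frob (An h - A (tn + h)) <= expR (LF * h) * frob (Y0 - A tn).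
Proof.
move=> Flip t00 t0n h0 tnT [An0 dAn] [_ dA].
pose D t := An t - A (tn + t).
pose dD t := F (tn + t) (An t) - F (tn + t) (A (tn + t)).
have := @gronwall_frob R m n D dD LF h h0.
rewrite /D An0 addr0; apply => [i j|t /andP[th0 th]].
  have HA : derives_on 0 h (fun t => A (tn + t) i j)
      (fun t => F (tn + t) (A (tn + t)) i j).
    have /(@derives_on_shift R t0 T tn) := derives_on_entry i j dA.
    by apply: derives_on_sub; rewrite ?subr_le0// lerBrDl.
  have := derives_onB (derives_on_entry i j dAn) HA.
  by congr (derives_on 0 h _ _); apply: funext => t; rewrite !mxE.
apply: Flip; rewrite in_itv /= addr_ge0// ?(le_trans t00)//=.
by rewrite (le_trans _ tnT)// lerD2l.
Qed.

Lemma step_const_ge0 s (tab : tableau R s) LF Mp Cst :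
  0 <= step_const m n r tab LF Mp Cst.
Proof.
rewrite /step_const /projection_const /increment_const.
by rewrite !(addr_ge0, mulr_ge0, sqrtr_ge0)// ?sumr_ge0// addr_ge0 ?sumr_ge0.
Qed.

Lemma increment_const_le s (tab : tableau R s) LF Mp Cst :
  increment_const m n tab LF Mp Cst <= step_const m n r tab LF Mp Cst.
Proof.
rewrite /step_const; set c := increment_const _ _ _ _ _ _.
have c0 : 0 <= c.
  by rewrite /c /increment_const !(addr_ge0, mulr_ge0)// ?sumr_ge0.
set a := projection_const _ _ _ * _; set b := projection_const _ _ _ * _.
have a0 : 0 <= a.
  by rewrite /a /projection_const !(addr_ge0, mulr_ge0, sqrtr_ge0).
have b0 : 0 <= b.
  by rewrite /b /projection_const !(addr_ge0, mulr_ge0, sqrtr_ge0).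
have := mulr_ge0 b0 c0; lra.
Qed.

(** Discrete Gronwall inequality. *)
Lemma error_recursion (e c a : R) (E : nat -> R) (k : nat) :
  0 <= a -> 0 <= c -> E 0%N <= e ->
  (forall i, (i < k)%N -> E i.+1 <= expR a * E i + c) ->
  E k <= expR (a * k%:R) * (e + k%:R * c).
Proof.
move=> a0 c0 E0; elim: k => [_|k IH Ek].
  by rewrite mulr0 expR0 mul1r mul0r addr0.
apply: le_trans (Ek k (ltnSn k)) _.
have /IH IHk : forall i, (i < k)%N -> E i.+1 <= expR a * E i + c.
  by move=> i ik; apply: Ek; rewrite ltnW.
have ak1 : 1 <= expR (a * k.+1%:R) by rewrite -expR0 ler_expR mulr_ge0.
have -> : expR (a * k.+1%:R) * (e + k.+1%:R * c)
    = expR a * (expR (a * k%:R) * (e + k%:R * c)) + expR (a * k.+1%:R) * c.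
  have -> : expR (a * k.+1%:R) = expR a * expR (a * k%:R).
    by rewrite -expRD -[k.+1]addn1 natrD; congr expR; ring.
  by rewrite -[k.+1]addn1 natrD; ring.
rewrite lerD ?ler_wpM2l ?expR_ge0//.
by rewrite ler_peMl.
Qed.

End Propagation.

Lemma step_radiusP (R : realType) (c h : R) : 0 <= c ->
  0 <= h -> h <= (2 * (c + 1))^-1 -> h * c <= 2^-1.
Proof.
move=> c0 h0; rewrite -[_^-1]mul1r ler_pdivlMr ?mulr_gt0 ?ltr_wpDl//.
by have := mulr_ge0 h0 c0; lra.
Qed.

Theorem theorem6p1 (R : realType) (m n r : nat) (LF : R)
    (hr : (1 <= r < minn m n)%N) :
  exists2 hstar : R, 0 < hstar &
  forall (p s : nat) (tab : tableau R s),
    (0 < p)%N -> explicit_tableau tab -> quadrature_conditions tab p ->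
  forall B Mp Cst : R,
  exists C : R,
    (forall (T eps : R) (F : R -> 'M[R]_(m, n) -> 'M[R]_(m, n)),
       0 < T -> standing_assumptions r T B LF eps F ->
     forall h0 h tn : R,
       0 < h -> h <= h0 -> h0 <= Num.min 1 hstar ->
       0 <= tn -> tn <= T - h ->
     forall (Xn Xn1 : factors R m n r) (Ys Fs : 'I_s -> 'M[R]_(m, n))
            (An : R -> 'M[R]_(m, n)),
       rank_r_factors Xn ->
       rk_step tab F tn h Xn Ys Fs Xn1 ->
       rk_admissible tab h Xn Fs ->
       step_assumptions tab F p Mp Cst eps tn h (fmat Xn) Ys An ->
     frob (fmat Xn + final_increment tab h Fs - An h)
       <= C * (h ^+ p.+1 + h ^+ 2 * eps) /\
     frob (fmat Xn1 - An h) <= C * (h ^+ p.+1 + h * eps)) /\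
    (forall T : R, 0 < T ->
     exists CT : R,
     forall (eps : R) (F : R -> 'M[R]_(m, n) -> 'M[R]_(m, n)),
       standing_assumptions r T B LF eps F ->
     forall h0 h t0 delta : R,
       0 < h -> h <= h0 -> h0 <= Num.min 1 hstar ->
       0 <= t0 -> t0 <= T ->
     forall (X : nat -> factors R m n r) (Ys Fs : nat -> 'I_s -> 'M[R]_(m, n))
            (An : nat -> R -> 'M[R]_(m, n))
            (A0 : 'M[R]_(m, n)) (A : R -> 'M[R]_(m, n)),
       rank_r_factors (X 0%N) ->
       (forall k : nat, t0 + k.+1%:R * h <= T ->
          [/\ rk_step tab F (t0 + k%:R * h) h (X k) (Ys k) (Fs k) (X k.+1),
              rk_admissible tab h (X k) (Fs k)
            & step_assumptions tab F p Mp Cst eps (t0 + k%:R * h) h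
                (fmat (X k)) (Ys k) (An k)]) ->
       solves_ivp F t0 T A0 A ->
       frob (fmat (X 0%N) - A t0) <= delta ->
     forall k : nat, t0 + k%:R * h <= T ->
       frob (fmat (X k) - A (t0 + k%:R * h)) <= CT * (delta + eps + h ^+ p)).
Proof.
have /andP[r0 /[!leq_min] /andP[rm rn]] := hr.
pose c := row_space_const (R := R) n r LF.
have c0 : 0 <= c.
  by rewrite /c /row_space_const !(addr_ge0, mulr_ge0, sqrtr_ge0).
exists (2 * (c + 1))^-1; first by rewrite invr_gt0 mulr_gt0// ltr_wpDl.
move=> p s tab p0 etab qtab B Mp Cst.
pose C := step_const m n r tab LF Mp Cst.
have C0 : 0 <= C by exact: step_const_ge0.
have step_size h0 h : 0 < h -> h <= h0 -> h0 <= Num.min 1 (2 * (c + 1))^-1 ->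
    h <= 1 /\ h * c <= 2^-1.
  move=> hp hh /(le_trans hh); rewrite le_min => /andP[h1 hc]; split=> //.
  by apply: step_radiusP => //; exact: ltW.
exists C; split.
  move=> T eps F T0 saF h0 h tn hp hh /(step_size _ _ hp hh)[h1 hc] tn0 tnT.
  move=> Xn Xn1 Ys Fs An rX step _ saX; split; last first.
    by apply: rk_step_error p0 r0 rm rn etab qtab saF hp tn0 tnT saX step rX h1 hc.
  apply: le_trans (increment_error p0 etab qtab saF hp tn0 tnT saX step) _.
  rewrite ler_wpM2r ?increment_const_le// addr_ge0 ?mulr_ge0 ?exprn_ge0 ?(ltW hp)//.
  exact: sa_eps_ge0 saF.
move=> T T0; exists (expR (`|LF| * T) * (1 + T * C)).
move=> eps F saF h0 h t0 delta hp hh /(step_size _ _ hp hh)[h1 hc] t00 t0T.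
move=> X Ys Fs An A0 A rX0 steps ivp A_delta k kT.
have eps0 := sa_eps_ge0 saF.
have h_ge0 := ltW hp.
have le_grid i : (i <= k)%N -> t0 + i%:R * h <= T.
  by move=> ik; apply: le_trans kT; rewrite lerD2l ler_wpM2r ?ler_nat.
have rX i : (i <= k)%N -> rank_r_factors (X i).
  elim: i => [//|i IH ik]; have [st adm _] := steps i (le_grid i.+1 ik).
  exact: rk_step_rank_r st (IH (ltnW ik)) adm.
have L0 : 0 <= `|LF| * h by rewrite mulr_ge0.
have b0 : 0 <= C * (h ^+ p.+1 + h * eps).
  by rewrite mulr_ge0// addr_ge0 ?mulr_ge0 ?exprn_ge0.
have rec i : (i < k)%N -> frob (fmat (X i.+1) - A (t0 + i.+1%:R * h))
    <= expR (`|LF| * h) * frob (fmat (X i) - A (t0 + i%:R * h))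
       + C * (h ^+ p.+1 + h * eps).
  move=> ik; have iT := le_grid i.+1 ik.
  have [st adm saX] := steps i iT.
  have tS : t0 + i.+1%:R * h = t0 + i%:R * h + h.
    by rewrite -[i.+1]addn1 natrD mulrDl mul1r addrA.
  have ti : 0 <= i%:R * h by rewrite mulr_ge0.
  have tnT : t0 + i%:R * h <= T - h by rewrite lerBrDr -tS.
  have local := rk_step_error p0 r0 rm rn etab qtab saF hp (addr_ge0 t00 ti) tnT
    saX st (rX i (ltnW ik)) h1 hc.
  have Flip t Y Z : t \in `[0, T] -> frob (F t Y - F t Z) <= `|LF| * frob (Y - Z).
    move=> tT; rewrite (le_trans (sa_lipschitz saF _ _ tT))//.
    by rewrite ler_wpM2r ?frob_ge0 ?ler_norm.
  have [An_ivp _ _ _] := saX.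
  have stab := flow_stability Flip t00 (_ : t0 <= t0 + i%:R * h) h_ge0 _ An_ivp ivp.
  rewrite -[_ - A _](subrKA (An i h)) tS addrC (le_trans (frobD _ _))// addrC.
  by rewrite addrC lerD// stab// ?lerDl// -tS.
have := error_recursion (E := fun i => frob (fmat (X i) - A (t0 + i%:R * h))) L0 b0 _ rec.
rewrite mul0r addr0 => /(_ _ A_delta) /le_trans; apply.
have kh : k%:R * h <= T by apply: le_trans kT; rewrite lerDr.
have kh0 : 0 <= k%:R * h by rewrite mulr_ge0.
have delta0 : 0 <= delta by apply: le_trans A_delta; exact: frob_ge0.
have hp0 : 0 <= h ^+ p by rewrite exprn_ge0.
have sum0 : 0 <= eps + h ^+ p by rewrite addr_ge0.
rewrite -!mulrA; apply: ler_pM; rewrite ?expR_ge0//.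
- by apply: addr_ge0 => //; apply: mulr_ge0.
- by rewrite ler_expR ler_wpM2l// mulrC.
have -> : k%:R * (C * (h ^+ p.+1 + h * eps)) = k%:R * h * (C * (eps + h ^+ p)).
  by rewrite exprS; ring.
have TC : k%:R * h * (C * (eps + h ^+ p)) <= T * C * (eps + h ^+ p).
  by rewrite -(mulrA T) ler_wpM2r// mulr_ge0.
have Td : 0 <= T * C * delta by rewrite !mulr_ge0// ltW.
by move: TC Td; move: (h ^+ p) sum0 => y; lra.
Qed.
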